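(* Let $p$ be a prime, let $G$ be a finite $p$-group, and let $H=Z(G)\cap\Phi(G)$, the intersection of the centre and the Frattini subgroup of $G$. Then $W_1(G)$ contains the image of $W(H)$ in $W(G)$.
   Context: Fix an algebraically closed field $k$ of characteristic $p$. For a finite group $G$, $H^*(G)$ is cohomology with coefficients $\mathbb Z_{(p)}$ (integers localized at $p$) and $H^\bullet(G)$ is its subring of elements of even degree, a finitely generated commutative $\mathbb Z_{(p)}$-algebra. $W(G)$ is the variety of all ring homomorphisms $H^\bullet(G)\to k$ with the Zariski topology, and $W_1(G)\subseteq W(G)$ is the closed subvariety of homomorphisms vanishing on the ideal $\{x\in H^\bullet(G):px=0\}$. For a subgroup $H\le G$, restriction $H^\bullet(G)\to H^\bullet(H)$ induces a map $W(H)\to W(G)$; ''the image of $W(H)$'' refers to this map. *)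

(* Defs.v *)
From HB Require Import structures.
From mathcomp Require Import all_boot all_order all_algebra all_fingroup all_solvable.
From mathcomp Require Import ring_quotient generic_quotient.
From mathcomp Require Import boolp classical_sets functions.

Set Implicit Arguments.
Unset Strict Implicit.
Unset Printing Implicit Defensive.

Import GRing.Theory.

Local Open Scope ring_scope.
Local Open Scope quotient_scope.

Definition local_rat (p : nat) : {pred rat} :=
  fun x => coprime p `|denq x|%N.

Lemma local_ratP p (x : rat) :
  reflect (exists2 d : nat, coprime p d & (0 < d)%N /\ exists n : int, x * d%:R = n%:~R)
          (x \in local_rat p).
Proof.
apply: (iffP idP) => [xp | [d cpd [d_gt0 [n Exd]]]].
  exists `|denq x|%N => //; split; first by rewrite absz_gt0 denq_neq0.
  by exists (numq x); rewrite numqE -[in RHS]absz_denq.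
apply: coprime_dvdr cpd.
have E : numq x * d%:Z = n * denq x.
  apply: (@intr_inj rat); rewrite !rmorphM /= numqE -Exd.
  by rewrite mulrAC.
have /= : (denq x %| numq x * d%:Z)%Z by rewrite E dvdz_mull.
rewrite dvdzE abszM Gauss_dvdr //.
by rewrite coprime_sym coprime_num_den.
Qed.

Lemma local_rat_subring p : subring_closed (local_rat p).
Proof.
split.
- by apply/local_ratP; exists 1%N; rewrite ?coprimen1 //; split=> //; exists 1.
- move=> x y /local_ratP[d cd [d0 [n En]]] /local_ratP[e ce [e0 [m Em]]].
  apply/local_ratP; exists (d * e)%N; first by rewrite coprimeMr cd.
  split; first by rewrite muln_gt0 d0.
  exists (n * e%:Z - m * d%:Z).
  rewrite natrM mulrBl mulrA En [y * _]mulrCA Em [d%:R * _]mulrC.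
  by rewrite rmorphB /= !intrM.
move=> x y /local_ratP[d cd [d0 [n En]]] /local_ratP[e ce [e0 [m Em]]].
apply/local_ratP; exists (d * e)%N; first by rewrite coprimeMr cd.
split; first by rewrite muln_gt0 d0.
by exists (n * m); rewrite intrM -En -Em natrM mulrACA.
Qed.

HB.instance Definition _ p :=
  GRing.isSubringClosed.Build rat (local_rat p) (local_rat_subring p).

(* For p prime, the integers localized at p: rationals in lowest terms with   *)
(* denominator prime to p.                                                    *)
Record Zloc (p : nat) := MkZloc { Zloc_val :> rat; _ : Zloc_val \in local_rat p }.
HB.instance Definition _ p := [isSub for @Zloc_val p].
HB.instance Definition _ p := [Choice of Zloc p by <:].
HB.instance Definition _ p := [SubChoice_isSubComNzRing of Zloc p by <:].

Section Cochains.
Variables (A : comNzRingType) (G : finGroupType).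
Implicit Types (f g h : seq G -> A) (s t : seq G).

(* Cohomology of G with trivial coefficients A, from the inhomogeneous        *)
(* (unnormalised) bar complex. All degrees are handled at once: a cochain is  *)
(* a function on words in G, whose degree n component is its restriction to   *)
(* the words of length n, i.e. a function G^n -> A. Finite degree means that  *)
(* only finitely many components are nonzero, so that the type cochain below  *)
(* is the direct sum of the C^n(G; A).                                        *)
Definition finite_degree f : Prop :=
  exists n, forall s, (n < size s)%N -> f s = 0.

Definition cochain_pred : {pred seq G -> A} := fun f => `[< finite_degree f >].

Lemma cochain_zmod_closed : zmod_closed cochain_pred.
Proof.
split=> [|f g /asboolP[n Hn] /asboolP[m Hm]]; first by apply/asboolP; exists 0.
apply/asboolP; exists (maxn n m) => s; rewrite gtn_max => /andP[ns ms].
by rewrite /= /GRing.add /= Hn // /GRing.opp /= Hm // subr0.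
Qed.

HB.instance Definition _ :=
  GRing.isZmodClosed.Build (seq G -> A) cochain_pred cochain_zmod_closed.

Record cochain := MkCochain { cochain_val :> seq G -> A; _ : cochain_val \in cochain_pred }.
HB.instance Definition _ := [isSub for cochain_val].
HB.instance Definition _ := [Choice of cochain by <:].
HB.instance Definition _ := [SubChoice_isSubZmodule of cochain by <:].

(* On components of degrees m and n this is                                   *)
(*   (f cup g)(x_1 ... x_(m+n)) = f(x_1 ... x_m) * g(x_(m+1) ... x_(m+n)).    *)
Definition cup f g s : A := \sum_(i < (size s).+1) f (take i s) * g (drop i s).

Lemma cup_nil f g : cup f g [::] = f [::] * g [::].
Proof. by rewrite /cup big_ord1. Qed.

Lemma cup_cons f g x s :
  cup f g (x :: s) = f [::] * g (x :: s) + cup (fun t => f (x :: t)) g s.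
Proof. by rewrite /cup big_ord_recl. Qed.

Lemma eq_cup f f' g g' : f =1 f' -> g =1 g' -> cup f g =1 cup f' g'.
Proof. by move=> Ef Eg s; apply: eq_bigr => i _; rewrite Ef Eg. Qed.

Lemma cupDl f g h s : cup (fun t => f t + g t) h s = cup f h s + cup g h s.
Proof. by rewrite /cup -big_split; apply: eq_bigr => i _; rewrite mulrDl. Qed.

Lemma cupDr f g h s : cup h (fun t => f t + g t) s = cup h f s + cup h g s.
Proof. by rewrite /cup -big_split; apply: eq_bigr => i _; rewrite mulrDr. Qed.

Lemma cupZl a f g s : cup (fun t => a * f t) g s = a * cup f g s.
Proof. by rewrite /cup mulr_sumr; apply: eq_bigr => i _; rewrite mulrA. Qed.

Lemma cupA f g h : cup f (cup g h) =1 cup (cup f g) h.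
Proof.
move=> s; elim: s f => [|x s IH] f; first by rewrite !cup_nil mulrA.
rewrite !cup_cons IH cup_nil mulrDr -!mulrA -addrA; congr (_ + _).
rewrite -cupZl -cupDl; apply: eq_cup => // t.
by rewrite cup_cons.
Qed.

Lemma cup_finite (c d : cochain) : cup c d \in cochain_pred.
Proof.
case: c d => [f /asboolP[n Hn]] [g /asboolP[m Hm]] /=; apply/asboolP.
exists (n + m)%N => s ls; rewrite /cup big1 // => i _.
have [le_in | lt_ni] := leqP i n; last first.
  by rewrite Hn ?mul0r // size_takel // -ltnS.
rewrite Hm ?mulr0 // size_drop ltn_subRL.
by apply: leq_ltn_trans ls; rewrite leq_add2r.
Qed.

Definition cochain_mul (c d : cochain) : cochain := MkCochain (cup_finite c d).

Definition cochain_one_val s : A := (size s == 0)%:R.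

Lemma cochain_one_subproof : cochain_one_val \in cochain_pred.
Proof. by apply/asboolP; exists 0%N => -[]. Qed.

Definition cochain_one : cochain := MkCochain cochain_one_subproof.

Lemma cochainP (c d : cochain) : (c : seq G -> A) =1 d -> c = d.
Proof. by move=> E; apply/val_inj/funext. Qed.

Lemma cochainD (c d : cochain) s : (c + d) s = c s + d s. Proof. by []. Qed.
Lemma cochainN (c : cochain) s : (- c) s = - c s. Proof. by []. Qed.
Lemma cochainB (c d : cochain) s : (c - d) s = c s - d s. Proof. by []. Qed.
Lemma cochain0 s : (0 : cochain) s = 0. Proof. by []. Qed.

Lemma cochain_mulA : associative cochain_mul.
Proof. by move=> c d e; apply: cochainP => s; apply: cupA. Qed.

Lemma cochain_mul1l : left_id cochain_one cochain_mul.
Proof.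
move=> c; apply: cochainP => s; rewrite /= /cup big_ord_recl /= big1 ?addr0.
  by rewrite take0 drop0 /cochain_one_val eqxx mul1r.
by move=> i _; rewrite /cochain_one_val size_takel ?mul0r // ltn_ord.
Qed.

Lemma cochain_mul1r : right_id cochain_one cochain_mul.
Proof.
move=> c; apply: cochainP => s; rewrite /= /cup big_ord_recr /= big1 ?add0r.
  by rewrite take_size drop_size /cochain_one_val eqxx mulr1.
move=> i _; rewrite /cochain_one_val size_drop subn_eq0 leqNgt ltn_ord.
by rewrite mulr0.
Qed.

Lemma cochain_mulDl : left_distributive cochain_mul +%R.
Proof. by move=> c d e; apply: cochainP => s; apply: cupDl. Qed.

Lemma cochain_mulDr : right_distributive cochain_mul +%R.
Proof. by move=> c d e; apply: cochainP => s; apply: cupDr. Qed.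

HB.instance Definition _ := GRing.Zmodule_isPzRing.Build cochain
  cochain_mulA cochain_mul1l cochain_mul1r cochain_mulDl cochain_mulDr.

Lemma cochainM (c d : cochain) s : (c * d) s = cup c d s. Proof. by []. Qed.

(* For s = x_1 ... x_n, face 0 drops x_1, face n drops x_n, and face i, with  *)
(* 0 < i < n, replaces x_i, x_(i+1) by their product. Not meaningful for      *)
(* i > n.                                                                     *)
Definition bar_face (i : nat) s : seq G :=
  if i == 0%N then behead s
  else if i == size s then take i.-1 s
  else take i.-1 s ++ (nth 1%g s i.-1 * nth 1%g s i)%g :: drop i.+1 s.

Definition coboundary f s : A :=
  if s is [::] then 0
  else \sum_(i < (size s).+1) (-1) ^+ i * f (bar_face i s).

Lemma bar_face_cons i x s : bar_face i.+2 (x :: s) = x :: bar_face i.+1 s.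
Proof. by rewrite /bar_face /= eqSS; case: eqP. Qed.

Lemma size_bar_face i s : (i <= size s)%N -> size (bar_face i s) = (size s).-1.
Proof.
elim: s i => [|x s IH] [|[|i]] //.
  by case: s {IH} => //= y s _; rewrite /bar_face /= drop0.
move=> lis; rewrite bar_face_cons /= IH //.
by case: s lis {IH}.
Qed.

Lemma bar_face_low i j s : (i <= j < size s)%N ->
  take j (bar_face i s) = bar_face i (take j.+1 s) /\
  drop j (bar_face i s) = drop j.+1 s.
Proof.
elim: s i j => [|x s IH] [|[|i]] [|j] //=; rewrite ?andbF //.
- by case: s {IH} => [|y s] //= _; rewrite /bar_face /= !drop0.
- by rewrite !bar_face_cons /= !ltnS => /IH [-> ->].
Qed.

Lemma bar_face_high i j s : (j < i <= size s)%N ->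
  take j (bar_face i s) = take j s /\
  drop j (bar_face i s) = bar_face (i - j) (drop j s).
Proof.
elim: s i j => [|x s IH] i [|j] //=; rewrite ?take0 ?drop0 ?subn0 //.
  by case: i => [|i]; rewrite ?ltn0 ?andbF //.
case: i => [|[|i]]; rewrite ?ltn0 // bar_face_cons /= !ltnS => /IH[-> ->].
by rewrite subSS.
Qed.

Lemma coboundaryE f s : s != [::] ->
  coboundary f s = \sum_(0 <= i < (size s).+1) (-1) ^+ i * f (bar_face i s).
Proof. by case: s => // x s _; rewrite big_mkord. Qed.

Definition cosign f s : A := (-1) ^+ size s * f s.

Lemma coboundary_cup f g s :
  coboundary (cup f g) s = cup (coboundary f) g s + cup (cosign f) (coboundary g) s.
Proof.
have [->|s0] := eqVneq s [::]; first by rewrite !cup_nil /= mul0r mulr0 addr0.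
have ms : (size s).-1.+1 = size s by case: (s) s0.
rewrite {2}/cup big_ord_recl take0 mul0r add0r.
rewrite {2}/cup big_ord_recr /= drop_size mulr0 addr0 -big_split /=.
rewrite coboundaryE // big_mkord.
transitivity (\sum_(i < (size s).+1) \sum_(j < size s)
   (-1) ^+ i * (f (take j (bar_face i s)) * g (drop j (bar_face i s)))).
  apply: eq_bigr => i _.
  by rewrite mulr_sumr size_bar_face ?ms // -ltnS.
rewrite exchange_big; apply: eq_bigr => -[j lt_jm] _ /=.
rewrite -(big_mkord xpredT (fun i => (-1) ^+ i *
  (f (take j (bar_face i s)) * g (drop j (bar_face i s))))).
rewrite (@big_cat_nat _ _ _ j.+1) //=; last by rewrite ltnS ltnW.
have tk0 : take j.+1 s != [::] by rewrite -size_eq0 size_takel.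
have dr0 : drop j s != [::] by rewrite -size_eq0 size_drop subn_eq0 -ltnNge.
rewrite !coboundaryE // size_takel // size_drop.
rewrite [in X in _ = X + _]big_nat_recr //= [in X in _ = _ + X]big_nat_recl //.
have -> : bar_face j.+1 (take j.+1 s) = take j s.
  by rewrite /bar_face /= size_takel // eqxx take_takel.
have -> : bar_face 0 (drop j s) = drop j.+1 s.
  by rewrite /bar_face /= -drop1 drop_drop add1n.
rewrite /bump leq0n add1n expr0 mul1r mulrDl mulrDr.
have -> (x y z t : A) : y + z = 0 -> x + y + (z + t) = x + t.
  by move=> yz; rewrite addrA -[x + y + z]addrA yz addr0.
2: { rewrite /cosign size_takel ?(ltnW lt_jm) // exprS !mulN1r !mulNr.
     by rewrite addNr. }
congr (_ + _).
  rewrite mulr_suml big_nat [RHS]big_nat; apply: eq_bigr => i /andP[_ lij].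
  have [|-> ->] := @bar_face_low i j s; first by rewrite -ltnS lij.
  by rewrite mulrA.
rewrite -{1}[j.+1]add0n big_addn subSS mulr_sumr.
rewrite big_nat [RHS]big_nat; apply: eq_bigr => i /andP[_ lij].
have [|-> ->] := @bar_face_high (i + j.+1) j s.
  by rewrite addnS ltnS leq_addl addnC -ltn_subRL.
rewrite /cosign size_takel ?(ltnW lt_jm) // addnS subSn ?leq_addl // addnK.
by rewrite mulrACA -exprD addnS [(i + j)%N]addnC.
Qed.

Lemma coboundary_finite (b : cochain) : coboundary b \in cochain_pred.
Proof.
case: b => [f /= /asboolP[n Hn]]; apply/asboolP; exists n.+1 => s ls /=.
rewrite coboundaryE; last by case: (s) ls.
rewrite big_nat big1 // => i /andP[_ li]; rewrite Hn ?mulr0 //.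
by rewrite size_bar_face ?ltn_predRL // -ltnS.
Qed.

Definition delta (b : cochain) : cochain := MkCochain (coboundary_finite b).

Lemma delta_is_zmod_morphism : zmod_morphism delta.
Proof.
move=> b c; apply: cochainP => -[|x s]; rewrite cochainB /= ?subrr //.
by rewrite -sumrB; apply: eq_bigr => i _; rewrite -mulrBr.
Qed.
HB.instance Definition _ :=
  GRing.isZmodMorphism.Build cochain cochain delta delta_is_zmod_morphism.

Lemma cosign_finite (b : cochain) : cosign b \in cochain_pred.
Proof.
case: b => [f /= /asboolP[n Hn]]; apply/asboolP; exists n => s ls.
by rewrite /cosign Hn ?mulr0.
Qed.

Definition csign (b : cochain) : cochain := MkCochain (cosign_finite b).

Lemma csignK : involutive csign.
Proof.
by move=> b; apply: cochainP => s; rewrite /= /cosign mulrA -expr2 sqrr_sign mul1r.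
Qed.

Lemma delta_csign b : delta (csign b) = - csign (delta b).
Proof.
apply: cochainP => -[|x s]; rewrite cochainN /= /cosign ?mulr0 ?oppr0 //.
rewrite mulr_sumr -sumrN; apply: eq_bigr => i _.
rewrite size_bar_face /=; last by rewrite -ltnS.
by rewrite exprS !mulN1r !mulNr opprK mulrCA.
Qed.

Lemma delta_mul b c : delta (b * c) = delta b * c + csign b * delta c.
Proof. by apply: cochainP => s; apply: coboundary_cup. Qed.

Definition cocycle_pred : {pred cochain} := fun c => delta c == 0.

Lemma cocycle_subring_closed : subring_closed cocycle_pred.
Proof.
split; rewrite /cocycle_pred.
- apply/eqP/cochainP => -[|x s] //=.
  transitivity (coboundary (@cochain_one_val) (x :: s)) => //.
  rewrite coboundaryE // big_nat.
  under eq_bigr => i /andP[_ li] do rewrite /cochain_one_val size_bar_face //=.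
  case: s => [|y s] /=; last by rewrite big1 // => i _; rewrite mulr0.
  by rewrite -big_nat !big_nat_recr //= big_nil add0r !mulr1 addrN.
- move=> b c; rewrite !unfold_in => /eqP db /eqP dc.
  by rewrite raddfB /= db dc subrr.
- move=> b c; rewrite !unfold_in => /eqP db /eqP dc.
  by rewrite delta_mul db dc mul0r mulr0 addr0.
Qed.

HB.instance Definition _ :=
  GRing.isSubringClosed.Build cochain cocycle_pred cocycle_subring_closed.

Record cocycle := MkCocycle { cocycle_val :> cochain; _ : cocycle_val \in cocycle_pred }.
HB.instance Definition _ := [isSub for cocycle_val].
HB.instance Definition _ := [Choice of cocycle by <:].
HB.instance Definition _ := GRing.SubChoice_isSubPzRing.Build cochain cocycle_pred cocycle
  cocycle_subring_closed.

Definition coboundary_pred : {pred cocycle} :=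
  fun c => `[< exists b : cochain, cocycle_val c = delta b >].

Lemma coboundary_zmod_closed : zmod_closed coboundary_pred.
Proof.
split=> [|x y /asboolP[b Eb] /asboolP[c Ec]]; apply/asboolP.
  by exists 0; rewrite raddf0.
by exists (b - c); rewrite raddfB /= -Eb -Ec.
Qed.

HB.instance Definition _ :=
  GRing.isZmodClosed.Build cocycle coboundary_pred coboundary_zmod_closed.

Lemma cocycleP (x : cocycle) : delta x = 0.
Proof. by case: x => c /= /eqP. Qed.

Lemma coboundary_mull (x y : cocycle) :
  y \in coboundary_pred -> x * y \in coboundary_pred.
Proof.
case/asboolP=> b Eb; apply/asboolP; exists (csign x * b).
rewrite delta_mul delta_csign csignK cocycleP -Eb.
have -> : csign 0 = 0 by apply: cochainP => s; rewrite /= /cosign mulr0.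
by rewrite oppr0 mul0r add0r.
Qed.

Lemma coboundary_mulr (x y : cocycle) :
  x \in coboundary_pred -> x * y \in coboundary_pred.
Proof.
case/asboolP=> b Eb; apply/asboolP; exists (b * y).
by rewrite delta_mul cocycleP mulr0 addr0 -Eb.
Qed.

(* The direct sum of all H^n(G; A). *)
Definition cohomology := {ideal_quot coboundary_pred}.
HB.instance Definition _ := GRing.Zmodule.on cohomology.

Definition cclass (c : cocycle) : cohomology := \pi_({ideal_quot coboundary_pred}) c.

Lemma cclass_eq (c d : cocycle) :
  cclass c = cclass d <-> c - d \in coboundary_pred.
Proof. by rewrite Quotient.idealrBE; split=> /eqP. Qed.

Lemma cclass_repr (x : cohomology) : cclass (repr x) = x.
Proof. exact: reprK. Qed.

Lemma cclass_is_zmod_morphism : zmod_morphism cclass.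
Proof. exact: (raddfB (\pi_({ideal_quot coboundary_pred}))). Qed.
HB.instance Definition _ :=
  GRing.isZmodMorphism.Build cocycle cohomology cclass cclass_is_zmod_morphism.

Definition cohomology_mul (x y : cohomology) : cohomology :=
  cclass (repr x * repr y).

Lemma cclassM_subproof c d : cclass (c * d) = cohomology_mul (cclass c) (cclass d).
Proof.
apply/cclass_eq; set c' := repr (cclass c); set d' := repr (cclass d).
have /cclass_eq Hc : cclass c = cclass c' by rewrite cclass_repr.
have /cclass_eq Hd : cclass d = cclass d' by rewrite cclass_repr.
have -> : c * d - c' * d' = (c - c') * d + c' * (d - d').
  by rewrite mulrBl mulrBr addrA subrK.
by apply: rpredD; [apply: coboundary_mulr | apply: coboundary_mull].
Qed.

Lemma cohomology_mulA : associative cohomology_mul.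
Proof.
move=> x y z; rewrite -(cclass_repr x) -(cclass_repr y) -(cclass_repr z).
by rewrite -!cclassM_subproof mulrA.
Qed.
Lemma cohomology_mul1l : left_id (cclass 1) cohomology_mul.
Proof. by move=> x; rewrite -(cclass_repr x) -!cclassM_subproof mul1r. Qed.
Lemma cohomology_mul1r : right_id (cclass 1) cohomology_mul.
Proof. by move=> x; rewrite -(cclass_repr x) -!cclassM_subproof mulr1. Qed.
Lemma cohomology_mulDl : left_distributive cohomology_mul +%R.
Proof.
move=> x y z; rewrite -(cclass_repr x) -(cclass_repr y) -(cclass_repr z).
by rewrite -raddfD /= -!cclassM_subproof mulrDl raddfD.
Qed.
Lemma cohomology_mulDr : right_distributive cohomology_mul +%R.
Proof.
move=> x y z; rewrite -(cclass_repr x) -(cclass_repr y) -(cclass_repr z).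
by rewrite -raddfD /= -!cclassM_subproof mulrDr raddfD.
Qed.

HB.instance Definition _ := GRing.Zmodule_isPzRing.Build cohomology
  cohomology_mulA cohomology_mul1l cohomology_mul1r cohomology_mulDl cohomology_mulDr.

Lemma cclass_is_monoid_morphism : monoid_morphism cclass.
Proof. by split=> // c d; rewrite cclassM_subproof. Qed.
HB.instance Definition _ :=
  GRing.isMonoidMorphism.Build cocycle cohomology cclass cclass_is_monoid_morphism.

(* Vanishes on words of odd length, i.e. has components in even degrees only. *)
Definition even_cochain (c : cochain) : Prop := forall s, odd (size s) -> c s = 0.

Definition even_pred : {pred cohomology} :=
  fun x => `[< exists2 c : cocycle, even_cochain c & x = cclass c >].

Lemma even_subring_closed : subring_closed even_pred.
Proof.
split.
- by apply/asboolP; exists 1; rewrite ?rmorph1 // => -[].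
- move=> x y /asboolP[c ec ->] /asboolP[d ed ->]; apply/asboolP; exists (c - d).
    by move=> s os; rewrite /= -[LHS]/(c s - d s) ec // ed // subrr.
  by rewrite rmorphB.
- move=> x y /asboolP[c ec ->] /asboolP[d ed ->]; apply/asboolP; exists (c * d).
    move=> s os; rewrite /= /cup big1 // => i _.
    move: os; rewrite -{1}(cat_take_drop i s) size_cat oddD.
    have [/ec -> _|_ /= /ed ->] := boolP (odd (size (take i s))).
      by rewrite mul0r.
    by rewrite mulr0.
  by rewrite rmorphM.
Qed.

HB.instance Definition _ :=
  GRing.isSubringClosed.Build cohomology even_pred even_subring_closed.

Record even_cohomology :=
  MkEven { even_val :> cohomology; _ : even_val \in even_pred }.
HB.instance Definition _ := [isSub for even_val].
HB.instance Definition _ := [Choice of even_cohomology by <:].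
HB.instance Definition _ := GRing.SubChoice_isSubPzRing.Build cohomology even_pred
  even_cohomology even_subring_closed.

End Cochains.

Section Restriction.
Variables (A : comNzRingType) (G H : finGroupType) (f : H -> G).
Hypothesis fM : {morph f : x y / (x * y)%g}.

Lemma bar_face_map i s : (i <= size s)%N ->
  bar_face i (map f s) = map f (bar_face i s).
Proof.
elim: s i => [|x s IH] [|[|i]] //=; first by case: s {IH} => //= y s _;
  rewrite /bar_face /= !drop0 fM.
by move=> lis; rewrite !bar_face_cons IH.
Qed.

Definition pull_val (c : seq G -> A) : seq H -> A := fun s => c (map f s).

Lemma pull_finite (c : cochain A G) : pull_val c \in @cochain_pred A H.
Proof.
case: c => [g /= /asboolP[n Hn]]; apply/asboolP; exists n => s ls.
by rewrite /pull_val /= Hn ?size_map.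
Qed.

Definition cochain_pull (c : cochain A G) : cochain A H := MkCochain (pull_finite c).

Lemma cochain_pull_delta c : delta (cochain_pull c) = cochain_pull (delta c).
Proof.
apply: cochainP => -[|x s] //=; rewrite /pull_val /= size_map.
apply: eq_bigr => i _; congr (_ * _).
by rewrite -map_cons bar_face_map // -ltnS.
Qed.

Lemma cochain_pullM b c : cochain_pull (b * c) = cochain_pull b * cochain_pull c.
Proof.
apply: cochainP => s; rewrite !cochainM /= /pull_val /cup size_map.
by apply: eq_bigr => i _; rewrite map_take map_drop.
Qed.

Lemma cocycle_pull_subproof (c : cocycle A G) :
  cochain_pull c \in @cocycle_pred A H.
Proof.
rewrite unfold_in cochain_pull_delta cocycleP; apply/eqP.
exact: cochainP.
Qed.

Definition cocycle_pull (c : cocycle A G) : cocycle A H :=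
  MkCocycle (cocycle_pull_subproof c).

Definition cohomology_pull (x : cohomology A G) : cohomology A H :=
  cclass (cocycle_pull (repr x)).

Lemma cohomology_pull_class c : cohomology_pull (cclass c) = cclass (cocycle_pull c).
Proof.
apply/cclass_eq; set c' := repr _.
have /cclass_eq/asboolP[b Eb] : cclass c' = cclass c by rewrite cclass_repr.
apply/asboolP; exists (cochain_pull b).
by rewrite cochain_pull_delta -Eb; apply: cochainP.
Qed.

Lemma cohomology_pull_even x : x \in @even_pred A G -> cohomology_pull x \in @even_pred A H.
Proof.
case/asboolP=> c ec ->; apply/asboolP; exists (cocycle_pull c).
  by move=> s os; apply: ec; rewrite size_map.
by rewrite cohomology_pull_class.
Qed.

Lemma cohomology_pull_is_zmod_morphism : zmod_morphism cohomology_pull.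
Proof.
move=> x y; rewrite -(cclass_repr x) -(cclass_repr y) -raddfB /=.
rewrite !cohomology_pull_class -raddfB; congr cclass.
by apply/val_inj/cochainP.
Qed.

Lemma cohomology_pull_is_monoid_morphism : monoid_morphism cohomology_pull.
Proof.
split=> [|x y].
  rewrite -[1]/(cclass 1) cohomology_pull_class; congr cclass.
  by apply/val_inj/cochainP => s; rewrite /= /pull_val /= /cochain_one_val size_map.
rewrite -(cclass_repr x) -(cclass_repr y) -rmorphM /=.
rewrite !cohomology_pull_class -rmorphM; congr cclass.
by apply: val_inj; apply: cochain_pullM.
Qed.

HB.instance Definition _ := GRing.isZmodMorphism.Build (cohomology A G) (cohomology A H)
  cohomology_pull cohomology_pull_is_zmod_morphism.
HB.instance Definition _ := GRing.isMonoidMorphism.Build (cohomology A G) (cohomology A H)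
  cohomology_pull cohomology_pull_is_monoid_morphism.

Definition even_pull (x : even_cohomology A G) : even_cohomology A H :=
  MkEven (cohomology_pull_even (valP x)).

Lemma even_pull_is_zmod_morphism : zmod_morphism even_pull.
Proof. by move=> x y; apply: val_inj; rewrite /= !rmorphB. Qed.
Lemma even_pull_is_monoid_morphism : monoid_morphism even_pull.
Proof. by split=> [|x y]; apply: val_inj; rewrite /= (rmorph1, rmorphM). Qed.

HB.instance Definition _ := GRing.isZmodMorphism.Build (even_cohomology A G)
  (even_cohomology A H) even_pull even_pull_is_zmod_morphism.
HB.instance Definition _ := GRing.isMonoidMorphism.Build (even_cohomology A G)
  (even_cohomology A H) even_pull even_pull_is_monoid_morphism.

End Restriction.

Lemma sgval_morph (gT : finGroupType) (H : {group gT}) :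
  {morph (sgval : subg_of H -> gT) : x y / (x * y)%g}.
Proof. by []. Qed.

Definition res (A : comNzRingType) (G : finGroupType) (H : {group G}) :
    {rmorphism even_cohomology A G -> even_cohomology A (subg_of H)} :=
  even_pull (@sgval_morph G H).

Section Varieties.
Variables (p : nat) (k : closedFieldType).

Definition W (G : finGroupType) : Type :=
  {rmorphism even_cohomology (Zloc p) G -> k}.

(* The sets of this form are the Zariski closed subsets of W G. *)
Definition zero_locus (G : finGroupType) (I : set (even_cohomology (Zloc p) G)) :
    set (W G) :=
  [set phi : W G | forall x, I x -> phi x = 0]%classic.

Definition W1 (G : finGroupType) : set (W G) :=
  zero_locus [set x | x *+ p = 0]%classic.

Definition W_res (G : finGroupType) (H : {group G}) : W (subg_of H) -> W G :=
  fun phi => (phi : {rmorphism _ -> _}) \o res _ H.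

End Varieties.

Arguments W_res p k {G} H _.
Arguments zero_locus {p k G} I.
Arguments W1 p k G : clear implicits.

(* Main.v *)
Require Import Defs.
From mathcomp Require Import all_boot all_order all_algebra all_fingroup all_solvable.
From mathcomp Require Import boolp classical_sets.
From mathcomp Require Import ring zify.

(** Write x as the class of a cocycle c with p c = d b. Then b is a cocycle
    modulo p, and the point is that the restriction of b to H = Z(G) :&: 'Phi(G)
    lifts to an integral cocycle. Once this is known, b = y + d c' + p e on H
    with d y = 0, hence p c = p (d e) and c = d e on H: the restriction of x
    to H is zero, and every homomorphism to k kills it.

    Why the lift exists. For g in G, inserting g in all positions of a word of
    the central subgroup H, with alternating signs, is the slant product with
    the 1-cycle [g], along the homomorphism G x H -> G. It sends cocycles modulo
    p on G to cocycles modulo p on H, and its class is additive in g, that is,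
    a homomorphism from G to an elementary abelian p-group. So it vanishes on
    'Phi(G) (exact_insert_Phi). For h in H this says that the derivation D_h of
    H^*(H; F_p), given by insertion of h, kills the restriction of b.

    Now H is an abelian p-group, a product of cyclic groups with generators
    h_i, and H^*(H; F_p) is generated by classes x_i of degree 1 and classes y_i
    of degree 2 with D_(h_j) x_i = [i = j] and D_(h_j) y_i = 0. The elements
    killed by all D_h are the polynomials in the y_i, and the y_i come from
    integral classes (lifts_abelian).

    This last step is proved without computing the ring, by splitting off one
    cyclic factor, H = <h> x K, at the level of cochains: up to coboundaries and
    multiples of p, a cocycle z modulo p equals
      z|_K + Y * Q(z) + X * (D_h z - D_1 z)|_K
    where X and Y are the generators of degrees 1 and 2 for the cyclic factor,
    and Q is an explicit operator of degree -2 (decomposition). If all D_g z are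
    exact then so is the last term. Moreover Q commutes with d modulo p and is a
    left inverse of the product with Y, which itself commutes with D_g, so that
    all D_g Q(z) are exact too. One concludes by induction on the degree, for
    Q(z), and on the order of the group, for z|_K. *)

Set Implicit Arguments.
Unset Strict Implicit.
Unset Printing Implicit Defensive.

Import GRing.Theory.
Local Open Scope ring_scope.

(** * The bar differential, recursively on words *)

Section InnerBoundary.
Variables (A : comNzRingType) (G : finGroupType).
Implicit Types (f : seq G -> A) (s : seq G).

(** The faces of a word that keep its first letter, with signs starting at +.
    The remaining face, which deletes the first letter, is the only one that
    sees the action when coefficients are twisted, so it is kept apart. *)
Fixpoint inner f s : A :=
  if s is x :: s' then
    (if s' is y :: s'' then f ((x * y)%g :: s'') - inner (fun t => f (x :: t)) s'
     else f [::])
  else 0.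

Lemma inner_cons2 f x y s :
  inner f [:: x, y & s] = f ((x * y)%g :: s) - inner (fun t => f (x :: t)) (y :: s).
Proof. by []. Qed.

Lemma innerE f s : inner f s = \sum_(i < size s) (-1) ^+ i * f (bar_face i.+1 s).
Proof.
elim: s f => [|x [|y s] IH] f; first by rewrite big_ord0.
  by rewrite big_ord1 expr0 mul1r.
rewrite inner_cons2 IH [RHS]big_ord_recl expr0 mul1r -sumrN; congr (f _ + _).
  by rewrite /bar_face /= drop0.
apply: eq_bigr => i _; rewrite /= /bump leq0n add1n exprS mulN1r mulNr.
by rewrite bar_face_cons.
Qed.

Lemma coboundary_cons f x s : coboundary f (x :: s) = f s - inner f (x :: s).
Proof.
rewrite innerE [LHS]big_ord_recl expr0 mul1r -sumrN; congr (_ + _).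
by apply: eq_bigr => i _; rewrite /= /bump leq0n add1n exprS mulN1r mulNr.
Qed.

Lemma eq_inner f g : f =1 g -> inner f =1 inner g.
Proof. by move=> /funext ->. Qed.

Lemma inner_lin a f g s :
  inner (fun t => f t + a * g t) s = inner f s + a * inner g s.
Proof.
rewrite !innerE mulr_sumr -big_split; apply: eq_bigr => i _ /=; ring.
Qed.

Lemma innerB f g s : inner (fun t => f t - g t) s = inner f s - inner g s.
Proof.
by rewrite -mulN1r -inner_lin; apply: eq_inner => t; rewrite mulN1r.
Qed.

Lemma inner_sum (I : finType) (P : pred I) (F : I -> seq G -> A) s :
  inner (fun t => \sum_(i | P i) F i t) s = \sum_(i | P i) inner (F i) s.
Proof.
rewrite innerE; under [RHS]eq_bigr do rewrite innerE.
rewrite exchange_big; apply: eq_bigr => i _; exact: mulr_sumr.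
Qed.

Lemma coboundary_lin a f g s :
  coboundary (fun t => f t + a * g t) s = coboundary f s + a * coboundary g s.
Proof.
case: s => [|x s]; first by rewrite /= mulr0 addr0.
rewrite !coboundary_cons inner_lin; ring.
Qed.

Lemma eq_coboundary f g : f =1 g -> coboundary f =1 coboundary g.
Proof. by move=> /funext ->. Qed.

Lemma coboundary0 s : coboundary (fun=> 0 : A) s = 0.
Proof.
case: s => // x s; rewrite coboundary_cons innerE big1 ?subr0 // => i _.
exact: mulr0.
Qed.

Lemma coboundaryB f g s :
  coboundary (fun t => f t - g t) s = coboundary f s - coboundary g s.
Proof.
by rewrite -mulN1r -coboundary_lin; apply: eq_coboundary => t; rewrite mulN1r.
Qed.

(** The equation d d = 0, stripped of the faces that delete a first letter. *)
Lemma inner_inner f x y s :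
  inner (fun t => inner f (x :: t)) (y :: s) = inner f ((x * y)%g :: s).
Proof.
elim: s f x y => [|z s IH] f x y //.
rewrite inner_cons2 [inner f [:: x, _ & s]]inner_cons2.
rewrite [inner (fun t => inner f [:: x, y & t]) _](_ : _ =
    inner (fun t => f ((x * y)%g :: t)) (z :: s)
    - inner (fun t => inner (fun t => f (x :: t)) (y :: t)) (z :: s)); last first.
  by rewrite -innerB; apply: eq_inner.
rewrite IH [RHS]inner_cons2 mulgA; ring.
Qed.

Lemma coboundary_coboundary f s : coboundary (coboundary f) s = 0.
Proof.
case: s => [|x [|y s]] //; first by rewrite coboundary_cons subrr.
rewrite coboundary_cons inner_cons2 !coboundary_cons.
rewrite [inner (fun t => coboundary f (x :: t)) _](_ : _ =
    inner f (y :: s) - inner (fun t => inner f (x :: t)) (y :: s)); last first.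
  by rewrite -innerB; apply: eq_inner => t; rewrite coboundary_cons.
rewrite inner_inner; ring.
Qed.

Lemma eq_coboundary_size f g s :
  (forall t, size t = (size s).-1 -> f t = g t) -> coboundary f s = coboundary g s.
Proof.
case: s => // x s fg; apply: eq_bigr => i _.
by rewrite fg // size_bar_face // -ltnS.
Qed.

End InnerBoundary.

Lemma inner_map (A : comNzRingType) (G H : finGroupType) (j : H -> G)
    (jM : {morph j : x y / (x * y)%g}) (f : seq G -> A) s :
  inner (fun t => f (map j t)) s = inner f (map j s).
Proof.
elim: s f => [|x [|y s] IH] f //.
by rewrite inner_cons2 (IH (fun t => f (j x :: t))) /= jM.
Qed.

Lemma coboundary_map (A : comNzRingType) (G H : finGroupType) (j : H -> G)
    (jM : {morph j : x y / (x * y)%g}) (f : seq G -> A) s :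
  coboundary (fun t => f (map j t)) s = coboundary f (map j s).
Proof. by case: s => // x s; rewrite map_cons !coboundary_cons -map_cons inner_map. Qed.

(** * The homotopy given by a natural transformation

    A set X with a right action of H is seen as a groupoid with arrows
    g : x -> act x g. Two homomorphisms alpha, beta : H -> G, read as functors
    to G that forget the state, and elements tau x with
    alpha g * tau (act x g) = tau x * beta g form a natural transformation. It
    induces a chain homotopy on bar cochains, the alternating sum over the ways
    of walking along alpha, crossing by tau, and going on along beta. *)
Section Prism.
Variables (A : comNzRingType) (H G : finGroupType) (X : Type).
Variables (act : X -> H -> X) (alpha beta : H -> G) (tau : X -> G).

Fixpoint prism (f : seq G -> A) (x : X) (s : seq H) : A :=
  f (tau x :: map beta s) -
  (if s is g :: s' then prism (fun t => f (alpha g :: t)) (act x g) s' else 0).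

Lemma prism_cons f x g s :
  prism f x (g :: s) =
    f (tau x :: map beta (g :: s)) - prism (fun t => f (alpha g :: t)) (act x g) s.
Proof. by []. Qed.

Lemma prism_nil f x : prism f x [::] = f [:: tau x].
Proof. exact: subr0. Qed.

Lemma eq_prism f g : f =1 g -> prism f = prism g.
Proof. by move=> /funext ->. Qed.

Lemma prism_lin a f g x s :
  prism (fun t => f t + a * g t) x s = prism f x s + a * prism g x s.
Proof.
elim: s f g x => [|k s IH] f g x; first by rewrite !prism_nil.
rewrite !prism_cons (IH (fun t => f (alpha k :: t)) (fun t => g (alpha k :: t))); ring.
Qed.

Lemma prismB f g x s : prism (fun t => f t - g t) x s = prism f x s - prism g x s.
Proof.
rewrite -mulN1r -prism_lin; congr (_ x s).
by apply: eq_prism => t; rewrite mulN1r.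
Qed.

Lemma prism0 x s : prism (fun => 0) x s = 0.
Proof. by elim: s x => [|g s IH] x /=; rewrite ?IH subrr. Qed.

Lemma prism_eq0 f x s :
  (forall t, size t = (size s).+1 -> f t = 0) -> prism f x s = 0.
Proof.
elim: s f x => [|g s IH] f x f0; first by rewrite prism_nil f0.
rewrite prism_cons (f0 (_ :: _)) /= ?size_map // (IH (fun t => f (alpha g :: t))) ?subrr //.
by move=> t st; apply: f0; rewrite /= st.
Qed.

Hypothesis actM : forall x g k, act (act x g) k = act x (g * k)%g.
Hypotheses (alphaM : {morph alpha : x y / (x * y)%g}) (betaM : {morph beta : x y / (x * y)%g}).
Hypothesis tau_nat : forall x g, (alpha g * tau (act x g))%g = (tau x * beta g)%g.

(** The combinatorial core of the homotopy formula: the faces adjacent to the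
    crossing cancel in pairs by naturality, and what survives is the face where
    the crossing has moved past the last letter. *)
Lemma inner_prism f x g s :
  inner (prism f x) (g :: s) + inner f (tau x :: map beta (g :: s))
    - prism (fun t => inner f (alpha g :: t)) (act x g) s
  = f (alpha g :: map alpha s).
Proof.
elim: s f x g => [|k s IH] f x g.
  rewrite /= !subr0 tau_nat; ring.
have E1 : inner (fun t => prism f x (g :: t)) (k :: s) =
    inner (fun t => f [:: tau x, beta g & t]) (map beta (k :: s))
    - inner (prism (fun t => f (alpha g :: t)) (act x g)) (k :: s).
  by rewrite -(inner_map betaM) -innerB; apply: eq_inner => t; rewrite prism_cons.
have E2 : prism (fun t => inner f [:: alpha g, alpha k & t]) (act x (g * k)%g) s =
    prism (fun t => f (alpha (g * k)%g :: t)) (act x (g * k)%g) s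
    - prism (fun t => inner (fun t => f (alpha g :: t)) (alpha k :: t)) (act x (g * k)%g) s.
  by rewrite -prismB; congr (_ _ s); apply: eq_prism => t; rewrite alphaM.
have {IH} := IH (fun t => f (alpha g :: t)) (act x g) k.
rewrite [inner _ [:: g, k & s]]inner_cons2 E1 !prism_cons !actM E2 !map_cons.
rewrite !inner_cons2 tau_nat betaM.
by move=> <-; ring.
Qed.

(** The differential on cochains of the groupoid of the action of K on Y, or on
    cochains of K with values in the functions on Y: deleting the first letter
    moves the state. *)
Definition twisted_coboundary (Y : Type) (K : finGroupType) (actY : Y -> K -> Y)
    (F : Y -> seq K -> A) (y : Y) (s : seq K) : A :=
  if s is g :: s' then F (actY y g) s' - inner (F y) s else 0.

Lemma prism_homotopy (Y : Type) (actY : Y -> G -> Y) (y0 y1 : X -> Y)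
    (act_alpha : forall x g, actY (y0 x) (alpha g) = y0 (act x g))
    (act_tau : forall x, actY (y0 x) (tau x) = y1 x) (F : Y -> seq G -> A) x s :
  twisted_coboundary act (fun x => prism (F (y0 x)) x) x s
    + prism (twisted_coboundary actY F (y0 x)) x s
  = F (y1 x) (map beta s) - F (y0 x) (map alpha s).
Proof.
case: s => [|g s]; first by rewrite prism_nil /= act_tau add0r.
rewrite prism_cons /= act_tau -/(map beta (g :: s)) -(inner_prism (F (y0 x)) x g s).
have -> : prism (fun t => F (actY (y0 x) (alpha g)) t - inner (F (y0 x)) (alpha g :: t))
    (act x g) s = prism (F (y0 (act x g))) (act x g) s
                - prism (fun t => inner (F (y0 x)) (alpha g :: t)) (act x g) s.
  by rewrite -prismB; congr (_ _ s); apply: eq_prism => t; rewrite act_alpha.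
rewrite !map_cons /=; ring.
Qed.

End Prism.

(** * Inserting a central element *)
Section Insertion.
Variables (A : comNzRingType) (H G : finGroupType) (j : H -> G).
Implicit Types (f : seq G -> A) (s : seq H).

(** The slant product with the 1-cycle [g], along (g, x) |-> g * j x. An element
    that commutes with the image of j is a natural transformation from j to
    itself, so this is a prism. *)
Definition insert (g : G) f : seq H -> A :=
  prism (fun (_ : unit) (_ : H) => tt) j j (fun=> g) f tt.

Lemma insert_cons g f x s :
  insert g f (x :: s) =
    f (g :: map j (x :: s)) - insert g (fun t => f (j x :: t)) s.
Proof. by []. Qed.

Lemma insert_nil g f : insert g f [::] = f [:: g].
Proof. exact: prism_nil. Qed.

Lemma eq_insert g f f' : f =1 f' -> insert g f = insert g f'.
Proof. by move=> /funext ->. Qed.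

Lemma insert_lin g a f f' s :
  insert g (fun t => f t + a * f' t) s = insert g f s + a * insert g f' s.
Proof. exact: prism_lin. Qed.

Lemma insertB g f f' s :
  insert g (fun t => f t - f' t) s = insert g f s - insert g f' s.
Proof. exact: prismB. Qed.

Hypothesis jM : {morph j : x y / (x * y)%g}.

Lemma inner_insert g (gC : forall x, commute g (j x)) f x s :
  inner (insert g f) (x :: s) =
    f (map j (x :: s)) - inner f (g :: map j (x :: s))
    + insert g (fun t => inner f (j x :: t)) s.
Proof.
have <- := inner_prism (act := fun (_ : unit) (_ : H) => tt)
  (fun _ _ _ => erefl) jM jM (tau := fun=> g) (fun _ k => esym (gC k)) f tt x s.
rewrite /insert; ring.
Qed.

Lemma coboundary_insert g (gC : forall x, commute g (j x)) f s :
  coboundary (insert g f) s = - insert g (coboundary f) s.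
Proof.
case: s => [|x s].
  by rewrite insert_nil coboundary_cons /= subrr oppr0.
rewrite insert_cons !coboundary_cons inner_insert //.
have -> : insert g (fun t => coboundary f (j x :: t)) s =
  insert g f s - insert g (fun t => inner f (j x :: t)) s.
  by rewrite -insertB; congr (_ s); apply: eq_insert => t; rewrite coboundary_cons.
ring.
Qed.

(** The slant product with the 2-chain [g | h], that is, all insertions of g and
    h with g to the left of h. Since the boundary of [g | h] is
    [h] - [g * h] + [g], it compares insertion of g * h with those of g and
    h. *)
Fixpoint insert2 (g h : G) f s : A :=
  insert h (fun t => f (g :: t)) s +
  (if s is x :: s' then insert2 g h (fun t => f (j x :: t)) s' else 0).

Lemma insert2_cons g h f x s :
  insert2 g h f (x :: s) =
    insert h (fun t => f (g :: t)) (x :: s) + insert2 g h (fun t => f (j x :: t)) s.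
Proof. by []. Qed.

Lemma eq_insert2 g h f f' : f =1 f' -> insert2 g h f = insert2 g h f'.
Proof. by move=> /funext ->. Qed.

Lemma insert2_lin g h a f f' s :
  insert2 g h (fun t => f t + a * f' t) s = insert2 g h f s + a * insert2 g h f' s.
Proof.
elim: s f f' => [|x s IH] f f'.
  by rewrite /= !addr0 (insert_lin _ _ (fun t => f (g :: t))).
rewrite !insert2_cons (insert_lin _ _ (fun t => f (g :: t)) (fun t => f' (g :: t))).
rewrite (IH (fun t => f (j x :: t)) (fun t => f' (j x :: t))); ring.
Qed.

Lemma insert2B g h f f' s :
  insert2 g h (fun t => f t - f' t) s = insert2 g h f s - insert2 g h f' s.
Proof.
rewrite -mulN1r -insert2_lin; congr (_ s).
by apply: eq_insert2 => t; rewrite mulN1r.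
Qed.

Section Central.
Variables (g h : G).
Hypotheses (gC : forall x, commute g (j x)) (hC : forall x, commute h (j x)).

Lemma inner_insert2 f x s :
  inner (insert2 g h f) (x :: s) =
    insert h (fun t => inner f (g :: t)) (x :: s)
    + insert2 g h (fun t => inner f (j x :: t)) s
    + insert g f (x :: s) - insert (g * h)%g f (x :: s).
Proof.
elim: s f x => [|k s IH] f x.
  rewrite !insert_cons /= !insert_nil /= (gC x) (hC x); ring.
rewrite inner_cons2.
have -> : inner (fun t => insert2 g h f (x :: t)) (k :: s) =
    inner (fun t => f [:: g, h, j x & t]) (map j (k :: s))
    - inner (insert h (fun t => f [:: g, j x & t])) (k :: s)
    + inner (insert2 g h (fun t => f (j x :: t))) (k :: s).
  rewrite -(inner_map jM) -innerB -[X in _ + X]mul1r -inner_lin.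
  by apply: eq_inner => t; rewrite mul1r insert2_cons insert_cons.
rewrite (inner_insert hC) IH.
have E1 : insert h (fun t => inner f [:: g, j x & t]) (k :: s) =
    insert h (fun t => f ((g * j x)%g :: t)) (k :: s)
    - insert h (fun t => inner (fun t => f (g :: t)) (j x :: t)) (k :: s).
  by rewrite -insertB.
have E1' : insert h (fun t => inner (fun t => f (g :: t)) (j x :: t)) (k :: s) =
    inner (fun t => f (g :: t)) [:: j x, h & map j (k :: s)] -
     (insert h (fun t => f [:: g, j (x * k)%g & t]) s
      - insert h (fun t => inner (fun t => f [:: g, j x & t]) (j k :: t)) s).
  rewrite insert_cons -insertB; congr (_ - _ s).
  by apply: eq_insert => t; rewrite inner_cons2 jM.
have E2 : insert2 g h (fun t => inner f (j x :: t)) (k :: s) =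
    (insert h (fun t => f ((j x * g)%g :: t)) (k :: s)
     - insert h (fun t => inner (fun t => f (j x :: t)) (g :: t)) (k :: s))
    + (insert2 g h (fun t => f (j (x * k)%g :: t)) s
       - insert2 g h (fun t => inner (fun t => f (j x :: t)) (j k :: t)) s).
  rewrite insert2_cons; congr (_ + _); first by rewrite -insertB.
  by rewrite -insert2B; congr (_ s); apply: eq_insert2 => t; rewrite jM.
rewrite [insert h (fun t => inner f (g :: t)) _]insert_cons E1 E1' E2.
rewrite insert2_cons (insert_cons g f) (insert_cons (g * h)%g f).
rewrite (insert_cons h (fun t => f (g :: t))) !map_cons !inner_cons2 jM gC.
rewrite (hC x); ring.
Qed.

Lemma coboundary_insert2 f s :
  coboundary (insert2 g h f) s =
    insert2 g h (coboundary f) s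
    + (insert (g * h)%g f s - insert g f s - insert h f s).
Proof.
case: s => [|x s].
  rewrite /insert2 !insert_nil coboundary_cons inner_cons2 /=; ring.
have E1 : insert h (fun t => coboundary f (g :: t)) (x :: s) =
    insert h f (x :: s) - insert h (fun t => inner f (g :: t)) (x :: s).
  by rewrite -insertB; congr (_ _); apply: eq_insert => t; rewrite coboundary_cons.
have E2 : insert2 g h (fun t => coboundary f (j x :: t)) s =
    insert2 g h f s - insert2 g h (fun t => inner f (j x :: t)) s.
  by rewrite -insert2B; congr (_ s); apply: eq_insert2 => t; rewrite coboundary_cons.
rewrite insert2_cons coboundary_cons inner_insert2 E1 E2; ring.
Qed.
End Central.
End Insertion.

Lemma insert_map (A : comNzRingType) (H G : finGroupType) (j : H -> G) g
    (f : seq G -> A) s : insert j g f s = insert id g f (map j s).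
Proof.
elim: s f => [|x s IH] f //.
by rewrite map_cons !insert_cons IH map_id.
Qed.

Lemma insert_pull (A : comNzRingType) (H G : finGroupType) (j : H -> G) h
    (f : seq G -> A) s :
  insert id h (fun t => f (map j t)) s = insert id (j h) f (map j s).
Proof.
elim: s f => [|x s IH] f //.
by rewrite map_cons !insert_cons (IH (fun t => f (j x :: t))) !map_id.
Qed.

(** * Cochains modulo q

    Reduction modulo q is expressed inside A, because in the end an equality
    modulo q of integral cochains has to be divided by q. Cochains need not be
    homogeneous or of finite degree here. *)
Section Mod.
Variables (A : comNzRingType) (q : A).

Definition exact_mod (G : finGroupType) (f : seq G -> A) :=
  exists c e : seq G -> A, forall s, f s = coboundary c s + q * e s.

Definition cocycle_mod (G : finGroupType) (f : seq G -> A) :=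
  exists e : seq G -> A, forall s, coboundary f s = q * e s.

Lemma exact_mod_lin (G : finGroupType) a (f g : seq G -> A) :
  exact_mod f -> exact_mod g -> exact_mod (fun s => f s + a * g s).
Proof.
move=> [c [e Ef]] [c' [e' Eg]].
exists (fun s => c s + a * c' s), (fun s => e s + a * e' s) => s.
rewrite coboundary_lin Ef Eg; ring.
Qed.

Lemma eq_exact_mod (G : finGroupType) (f g : seq G -> A) :
  f =1 g -> exact_mod f -> exact_mod g.
Proof. by move=> /funext ->. Qed.

Lemma exact_mod_mul (G : finGroupType) (e : seq G -> A) :
  exact_mod (fun s => q * e s).
Proof.
exists (fun=> 0), e => s.
by rewrite coboundary0 add0r.
Qed.

Lemma exact_mod_pull (G H : finGroupType) (j : H -> G)
    (jM : {morph j : x y / (x * y)%g}) (f : seq G -> A) :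
  exact_mod f -> exact_mod (fun s => f (map j s)).
Proof.
move=> [c [e Ef]]; exists (fun s => c (map j s)), (fun s => e (map j s)) => s.
by rewrite Ef coboundary_map.
Qed.

Lemma cocycle_mod_pull (G H : finGroupType) (j : H -> G)
    (jM : {morph j : x y / (x * y)%g}) (f : seq G -> A) :
  cocycle_mod f -> cocycle_mod (fun s => f (map j s)).
Proof.
by move=> [e Ef]; exists (fun s => e (map j s)) => s; rewrite coboundary_map.
Qed.

End Mod.

(** * Insertion of elements of the Frattini subgroup *)
Section Frattini.
Variables (A : comNzRingType) (p : nat) (G H : finGroupType) (j : H -> G).
Hypotheses (jM : {morph j : x y / (x * y)%g}) (jC : forall g x, commute g (j x)).
Variable f : seq G -> A.
Hypothesis cf : cocycle_mod p%:R f.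

Let P g := exact_mod p%:R (insert j g f).

(** Additivity of the class of an insertion in the inserted element. *)
Lemma exact_insertM_diff g h :
  exact_mod p%:R (fun s => insert j (g * h)%g f s - insert j g f s - insert j h f s).
Proof.
case: cf => e Ef; exists (insert2 j g h f), (fun s => - insert2 j g h e s) => s.
have E0 t : 0 = insert2 j g h (fun=> 0 : A) t.
  rewrite -[LHS](subrr (insert2 j g h (fun=> 0) t)) -insert2B.
  by congr (_ t); apply: eq_insert2 => u; rewrite subrr.
rewrite (coboundary_insert2 jM (jC g) (jC h)).
have -> : insert2 j g h (coboundary f) s = p%:R * insert2 j g h e s.
  rewrite -[RHS]add0r (E0 s) -insert2_lin; congr (_ s); apply: eq_insert2 => t.
  by rewrite Ef add0r.
ring.
Qed.

Lemma exact_insertM g h : P g -> P h -> P (g * h)%g.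
Proof.
move=> Pg Ph; have := exact_mod_lin 1 (exact_mod_lin 1 (exact_insertM_diff g h) Pg) Ph.
by apply: eq_exact_mod => s; ring.
Qed.

Lemma exact_insert1 : P 1%g.
Proof.
have := exact_mod_lin (-2) (exact_insertM_diff 1%g 1%g) (exact_insertM_diff 1%g 1%g).
by apply: eq_exact_mod => s; rewrite mulg1; ring.
Qed.

Lemma exact_insertX g n :
  exact_mod p%:R (fun s => insert j (g ^+ n)%g f s - n%:R * insert j g f s).
Proof.
elim: n => [|n IH].
  by apply: eq_exact_mod exact_insert1 => s; rewrite mul0r subr0.
have := exact_mod_lin 1 (exact_insertM_diff g (g ^+ n)%g) IH.
by apply: eq_exact_mod => s; rewrite expgS; ring.
Qed.

Lemma exact_insertR g h : P [~ g, h].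
Proof.
have H1 := exact_insertM_diff g h.
have H2 := exact_insertM_diff h g.
have H3 := exact_insertM_diff (h * g)%g [~ g, h].
have := exact_mod_lin (-1) (exact_mod_lin (-1) H1 H2) H3.
by apply: eq_exact_mod => s; rewrite -commgC; ring.
Qed.

(** The class of insert j g f is a homomorphism in g to a group killed by p, so
    it is trivial on commutators and on p-th powers, which generate the Frattini
    subgroup of a p-group. *)
Lemma exact_insert_Phi (pG : (p.-group [set: G])%g) g :
  g \in 'Phi([set: G])%g -> P g.
Proof.
have gP : group_set [set x | `[< P x >]].
  apply/group_setP; split=> [|x y]; rewrite !inE; first exact: exact_insert1.
  exact: exact_insertM.
suff : ('Phi([set: G]) \subset Group gP)%g.
  by move=> /fintype.subsetP S gPhi; have := S g gPhi; rewrite inE => /asboolP.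
rewrite (Phi_joing pG) join_subG; apply/andP; split.
  rewrite gen_subG; apply/fintype.subsetP => _ /imset2P[x y _ _ ->].
  by rewrite inE; apply/asboolP; exact: exact_insertR.
rewrite (MhoE 1 pG) gen_subG; apply/fintype.subsetP => _ /imsetP[x _ ->].
rewrite inE expn1; apply/asboolP.
have := exact_mod_lin 1 (exact_insertX x p) (exact_mod_mul p%:R (insert j x f)).
by apply: eq_exact_mod => s; ring.
Qed.
End Frattini.

(** * Splitting off a cyclic factor *)
Section Carry.
Variables (A : comNzRingType) (n : nat).

(** The 2-cocycle of the extension Z -> Z -> Z/(n+1), multiplication by n+1
    followed by reduction. It represents the degree 2 generator of the integral
    cohomology of a cyclic group. *)
Definition carry (a b : 'I_n.+1) : A := (n < a + b)%N%:R.

Lemma carryC a b : carry a b = carry b a.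
Proof. by rewrite /carry addnC. Qed.

Lemma carry0 b : carry 0 b = 0.
Proof. by rewrite /carry add0n ltnNge -ltnS ltn_ord. Qed.

Lemma val_addI (a b : 'I_n.+1) :
  (a + b)%R = (if (n < a + b)%N then a + b - n.+1 else a + b)%N :> nat.
Proof.
have := ltn_ord a; have := ltn_ord b; rewrite /=.
move: (a : nat) (b : nat) => i k kn ln; case: ltnP => ik.
  rewrite -[in LHS](subnK ik) modnDr modn_small //; lia.
by rewrite modn_small.
Qed.

Lemma carry_cocycle (a b c : 'I_n.+1) :
  carry b c + carry a (b + c) = carry (a + b) c + carry a b.
Proof.
rewrite /carry -!natrD; congr (_%:R); rewrite !val_addI.
have := ltn_ord a; have := ltn_ord b; have := ltn_ord c.
do 2 case: ifP; lia.
Qed.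

Lemma val_addI_carry (a b : 'I_n.+1) :
  ((a + b)%R + n.+1 * (n < a + b) = a + b :> nat)%N.
Proof.
rewrite val_addI; have := ltn_ord a; have := ltn_ord b; case: ifP; lia.
Qed.

(** The cyclic interval of length a that starts at b is [0, a + b) minus [0, b),
    plus the whole circle if it wraps around; a + b is reduced modulo n.+1. *)
Lemma rotation_carry (a b i : 'I_n.+1) :
  (((i - b)%R < a) + (i < b) = (n < a + b) + (i < (a + b)%R))%N.
Proof.
have -> : (i - b)%R = (if i < b then i + n.+1 - b else i - b)%N :> nat.
  have := val_addI (i - b) b; rewrite subrK.
  have := ltn_ord (i - b); have := ltn_ord b; have := ltn_ord i.
  do 2 case: ifP; lia.
rewrite val_addI; have := ltn_ord a; have := ltn_ord b; have := ltn_ord i.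
do 2 case: ifP; lia.
Qed.

End Carry.

(** The group H is the direct product of the cyclic group of order n.+1
    generated by h and of K, with inclusion iota and projection pr; psi is the
    exponent of the component along h. The states are the elements of Z/(n+1),
    on which H acts through psi, so that functions of a state and a word are
    cochains of H with values in the module coinduced from K. *)
Section CyclicFactor.
Variables (A : comNzRingType) (H K : finGroupType) (n : nat).
Variables (h : H) (psi : H -> 'I_n.+1) (iota : K -> H) (pr : H -> K).
Hypotheses (n_gt0 : (0 < n)%N) (HC : forall x y : H, commute x y).
Hypotheses (psiM : {morph psi : x y / (x * y)%g >-> x + y}) (psi_h : psi h = 1%N :> nat).
Hypotheses (iotaM : {morph iota : x y / (x * y)%g}) (prM : {morph pr : x y / (x * y)%g}).
Hypotheses (iotaK : cancel iota pr) (pr_h : pr h = 1%g) (psi_iota : forall k, psi (iota k) = 0).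
Hypothesis split_psi : forall g, (iota (pr g) * h ^+ psi g)%g = g.

Local Notation carry := (@carry A n).

Implicit Types (z c v : seq H -> A) (F : 'I_n.+1 -> seq H -> A) (s : seq H) (x : 'I_n.+1).

Let r g := iota (pr g).
Let act x g : 'I_n.+1 := x + psi g.
Let tau x : H := (h ^+ x)%g.

Lemma retractM : {morph r : x y / (x * y)%g}.
Proof. by move=> x y; rewrite /r prM iotaM. Qed.

Lemma psi_retract g : psi (r g) = 0.
Proof. exact: psi_iota. Qed.

Lemma psi1 : psi 1%g = 0.
Proof. by apply: (addrI (psi 1%g)); rewrite -psiM mulg1 addr0. Qed.

Lemma psiX m : psi (h ^+ m)%g = (m %% n.+1)%N :> nat.
Proof.
elim: m => [|m IH]; first by rewrite psi1.
by rewrite expgS psiM /= IH psi_h modnDmr add1n.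
Qed.

Lemma psi_tau x : psi (tau x) = x.
Proof. by apply: val_inj; rewrite /= psiX modn_small. Qed.

Lemma expg_period : (h ^+ n.+1 = 1)%g.
Proof.
have prX m : pr (h ^+ m)%g = 1%g.
  elim: m => [|m IH]; last by rewrite expgS prM pr_h IH mulg1.
  by apply: (mulgI (pr 1%g)); rewrite -prM !mulg1.
rewrite -(split_psi (h ^+ n.+1)%g) psiX modnn mulg1 prX.
by apply: (mulgI (iota 1%g)); rewrite -iotaM !mulg1.
Qed.

(** The groupoid of states is equivalent to K, by retraction to the state 0; the
    powers of h are the arrows of this equivalence, natural from the retraction
    r to the identity. *)
Lemma tau_natural x g : (r g * tau (act x g))%g = (tau x * g)%g.
Proof.
rewrite /tau /act /= expg_mod ?expg_period // expgD -[in RHS](split_psi g).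
by rewrite mulgA (HC (r g)) mulgA.
Qed.

Lemma actM x g k : act (act x g) k = act x (g * k)%g.
Proof. by rewrite /act psiM addrA. Qed.

(** The prism of tau, by which a cochain with values in functions of the state
    is homotopic to its restriction to K at the state 0 (Shapiro's lemma). *)
Definition filler z x s : A := prism act r id tau z x s.
(** The variation of filler z between the states 0 and 1. The filler bounds
    z - z|_K, which is constant in the state, so this variation is a cocycle
    when z is; on words of K it is the derivation D_h z - D_1 z. *)
Definition jump z s : A := filler z (psi h) s - filler z 0 s.
(** The coefficient of the degree 2 generator. In the exact sequence
    A -> A[C] -> A[C] -> A of functions on the cyclic factor C, with middle map
    the difference operator and last map the sum, this is dimension shifting
    twice, each lifting being done by filler. *)
Definition gysin z s : A := \sum_x filler (jump z) x s.

Let d F x s : A := twisted_coboundary act F x s.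

Lemma d_cons F x g s : d F x (g :: s) = F (x + psi g) s - inner (F x) (g :: s).
Proof. by []. Qed.

Lemma d_const z x s : d (fun=> z) x s = coboundary z s.
Proof. by case: s => // g s; rewrite coboundary_cons. Qed.

Lemma filler_homotopy F x s :
  d (fun x => filler (F 0) x) x s + filler (d F 0) x s = F x s - F 0 (map r s).
Proof.
rewrite -[X in F x X](map_id s) /d /filler.
have E0 (y : 'I_n.+1) g : act 0 (r g) = 0 by rewrite /act add0r psi_retract.
have E1 y : act 0 (tau y) = y by rewrite /act add0r psi_tau.
have idM : {morph (@id H) : x y / (x * y)%g} by [].
exact: (prism_homotopy actM retractM idM tau_natural (actY := act)
  (y0 := fun=> 0) (y1 := id) E0 E1 F x s).
Qed.

Lemma filler_linr a z c x s :
  filler (fun t => z t + a * c t) x s = filler z x s + a * filler c x s.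
Proof. exact: prism_lin. Qed.

Lemma filler0 x s : filler (fun=> 0) x s = 0.
Proof. exact: prism0. Qed.

Lemma fillerZ a z x s : filler (fun t => a * z t) x s = a * filler z x s.
Proof.
rewrite -[RHS]add0r -(filler0 x s) -filler_linr; congr (prism _ _ _ _ _ x s).
by apply/funext => t; rewrite add0r.
Qed.

Lemma jumpZ a z s : jump (fun t => a * z t) s = a * jump z s.
Proof. by rewrite /jump !fillerZ mulrBr. Qed.

Lemma filler_jumpZ a z x s :
  filler (jump (fun t => a * z t)) x s = a * filler (jump z) x s.
Proof. by rewrite -fillerZ; congr (prism _ _ _ _ _ x s); apply/funext => t; exact: jumpZ. Qed.

Lemma gysinZ a z s : gysin (fun t => a * z t) s = a * gysin z s.
Proof. by rewrite mulr_sumr; apply: eq_bigr => x _; apply: filler_jumpZ. Qed.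

Lemma gysinD z c s : gysin (fun t => z t + c t) s = gysin z s + gysin c s.
Proof.
rewrite -big_split; apply: eq_bigr => x _ /=.
rewrite -[X in _ + X]mul1r -filler_linr; congr (prism _ _ _ _ _ x s).
apply/funext => t; rewrite /jump.
have -> : (fun t => z t + c t) = (fun t => z t + 1 * c t).
  by apply/funext => u; rewrite mul1r.
rewrite !filler_linr; ring.
Qed.

Lemma d_filler z x s :
  d (filler z) x s = z s - z (map r s) - filler (coboundary z) x s.
Proof.
have <- := filler_homotopy (fun=> z) x s.
have -> : d (fun=> z) 0 = coboundary z by apply/funext => t; exact: d_const.
by rewrite addrK.
Qed.

(** Shapiro's homotopy for the difference of filler z at consecutive states,
    whose value at the state 0 is jump z. *)
Lemma d_filler_jump z x s :
  d (filler (jump z)) x s =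
    filler z (x + psi h) s - filler z x s - jump z (map r s)
    + filler (jump (coboundary z)) x s.
Proof.
pose F x s := filler z (x + psi h) s - filler z x s.
have F0 : F 0 = jump z by apply/funext => t; rewrite /F add0r.
have dF : d F 0 = (fun t => (-1) * jump (coboundary z) t).
  apply/funext => t.
  have -> : d F 0 t = d (filler z) (psi h) t - d (filler z) 0 t.
    case: t => [|g t]; first by rewrite /= subrr.
    by rewrite !d_cons F0 innerB /F !add0r [psi g + _]addrC; ring.
  rewrite !d_filler /jump; ring.
have := filler_homotopy F x s; rewrite F0 dF fillerZ -/(F x s).
by move=> /(canRL (addrK _)) ->; rewrite mulN1r opprK.
Qed.

(** Summing over the states is a map to trivial coefficients, because the action
    permutes the states. *)
Lemma sum_d F s : \sum_x d F x s = coboundary (fun t => \sum_x F x t) s.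
Proof.
case: s => [|g s]; first by rewrite big1.
rewrite coboundary_cons inner_sum -sumrB.
rewrite [LHS]sumrB [RHS]sumrB; congr (_ - _).
rewrite [RHS](reindex_inj (addIr (psi g))); exact: eq_bigr.
Qed.

(** Chain map property modulo n.+1: the differences of filler z at consecutive
    states sum to zero around the circle, whereas the correction term is
    constant in the state, whence the factor n.+1. *)
Lemma coboundary_gysin z s :
  coboundary (gysin z) s = gysin (coboundary z) s - n.+1%:R * jump z (map r s).
Proof.
rewrite -sum_d; under eq_bigr do rewrite d_filler_jump.
rewrite big_split sumrB sumrB /= [X in X - _ - _](_ : _ = \sum_x filler z x s).
  by rewrite subrr sub0r sumr_const card_ord mulr_natl addrC.
by rewrite [RHS](reindex_inj (addIr (psi h))).
Qed.

Lemma gysin_eq0 D z : (forall s, (D < size s)%N -> z s = 0) ->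
  forall s, (D <= size s)%N -> gysin z s = 0.
Proof.
move=> z0 s Ds; rewrite /gysin big1 // => x _; apply: prism_eq0 => t st.
have f0 y : filler z y t = 0.
  by apply: prism_eq0 => u su; apply: z0; rewrite su st !ltnS leqW.
by rewrite /jump !f0 subrr.
Qed.

(** The products with the degree 2 class and, below, with the degree 1 cochain
    of the cyclic factor. *)
Definition ecup v s : A :=
  if s is [:: g, k & s'] then carry (psi g) (psi k) * v s' else 0.

Definition xcup v s : A := if s is g :: s' then (psi g : nat)%:R * v s' else 0.

Lemma coboundary_ecup v s : coboundary (ecup v) s = ecup (coboundary v) s.
Proof.
case: s => [|g [|k [|l s]]] //.
- by rewrite coboundary_cons /= subrr.
- by rewrite coboundary_cons /= mulr0 !subr0.
rewrite coboundary_cons !inner_cons2.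
have -> : inner (fun t => ecup v [:: g, k & t]) (l :: s)
    = carry (psi g) (psi k) * inner v (l :: s).
  rewrite -[LHS]/(inner (fun t => carry (psi g) (psi k) * v t) (l :: s)).
  by rewrite !innerE mulr_sumr; apply: eq_bigr => i _; rewrite mulrCA.
rewrite /ecup coboundary_cons !psiM.
have := carry_cocycle A (psi g) (psi k) (psi l).
move=> /(canRL (addrK _)) E; rewrite E; ring.
Qed.

Lemma coboundary_xcup v s :
  coboundary (xcup v) s = n.+1%:R * ecup v s - xcup (coboundary v) s.
Proof.
case: s => [|g [|k s]].
- by rewrite /= mulr0 subrr.
- by rewrite coboundary_cons /= !mulr0 !subrr.
rewrite coboundary_cons inner_cons2.
have -> : inner (fun t => xcup v (g :: t)) (k :: s) = (psi g : nat)%:R * inner v (k :: s).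
  rewrite -[LHS]/(inner (fun t => (psi g : nat)%:R * v t) (k :: s)).
  by rewrite !innerE mulr_sumr; apply: eq_bigr => i _; rewrite mulrCA.
rewrite /xcup /ecup coboundary_cons psiM /carry.
have /(congr1 (fun m => m%:R : A)) := val_addI_carry (psi g) (psi k).
rewrite !natrD natrM => /(canRL (addrK _)) ->.
ring.
Qed.

Lemma insert_ecup g v s : insert id g (ecup v) s = ecup (insert id g v) s.
Proof.
case: s => [|k [|l s]]; first exact: insert_nil.
  rewrite insert_cons insert_nil /= carryC; ring.
have -> : insert id g (ecup v) [:: k, l & s] =
   insert id g (fun t => carry (psi k) (psi l) * v t) s.
  rewrite !insert_cons /= !map_id carryC; ring.
have := insert_lin id g (carry (psi k) (psi l)) (fun=> 0) v s.
rewrite [X in _ = X + _]prism0 add0r => E; rewrite -[RHS]E.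
by congr (_ s); apply: eq_insert => t; rewrite add0r.
Qed.

(** Only the crossing in first position contributes: the others apply z to a word
    whose first letter is in K. *)
Lemma filler_vanish z : (forall g s, psi g = 0 -> z (g :: s) = 0) ->
  forall x s, filler z x s = z (tau x :: s).
Proof.
move=> z0 x [|g s]; first by rewrite /filler prism_nil.
rewrite /filler prism_cons map_id [X in _ - X](_ : _ = 0) ?subr0 //.
rewrite -[RHS](filler0 (act x g) s); congr (prism _ _ _ _ _ _ s).
by apply/funext => t; rewrite z0 // psi_retract.
Qed.

(** By filler_vanish, the filler and the jump just put a power of h and then h
    in front of the word. Adding h carries exactly at the last state. *)
Lemma gysin_ecup v s : gysin (ecup v) s = v s.
Proof.
have fE x t : filler (ecup v) x t = ecup v (tau x :: t).
  apply: filler_vanish => g [|k u] // g0.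
  by rewrite /ecup g0 carry0 mul0r.
have jE t : jump (ecup v) t = ecup v (h :: t).
  rewrite /jump !fE; have -> : tau (psi h) = h by rewrite /tau psi_h.
  case: t => [|k t]; first exact: subrr.
  by rewrite /ecup [in X in _ - X]psi_tau carry0 mul0r subr0.
rewrite /gysin (bigD1 ord_max) //= big1 ?addr0.
  rewrite filler_vanish ?jE => [|g t g0]; rewrite ?jE /ecup /carry.
    by rewrite psi_tau psi_h /= ltnSn mul1r.
  by rewrite g0 psi_h addn0 ltnNge n_gt0 mul0r.
move=> x xm; rewrite filler_vanish ?jE => [|g t g0]; rewrite ?jE /ecup /carry.
  rewrite psi_tau psi_h ltnNge; have -> : (1 + x <= n)%N; last by rewrite mul0r.
  by rewrite add1n ltn_neqAle -ltnS ltn_ord andbT.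
by rewrite g0 psi_h addn0 ltnNge n_gt0 mul0r.
Qed.

(** A discrete primitive around the circle. It inverts the difference operator
    up to constants, but commutes with the action only up to the carry, which is
    how the degree 2 class enters. *)
Definition below F x s : A := \sum_(i : 'I_n.+1 | (i < x)%N) F i s.

Lemma below_shift F (a b : 'I_n.+1) s :
  \sum_(i : 'I_n.+1 | (i < a)%N) F (i + b) s =
    below F (a + b) s + carry a b * (\sum_i F i s) - below F b s.
Proof.
rewrite /below [in LHS](reindex_inj (addIr (- b))) /=.
under eq_bigr do rewrite subrK.
rewrite mulr_sumr !(big_mkcond (fun i : 'I_n.+1 => (_ < _)%N)) /=.
rewrite -big_split -sumrB; apply: eq_bigr => i _ /=.
rewrite /carry.
have /(congr1 (fun m => m%:R * F i s)) := rotation_carry a b i.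
rewrite !natrD !mulrDl.
have bF (c : bool) : c%:R * F i s = if c then F i s else 0.
  by case: c; rewrite ?mul1r ?mul0r.
rewrite -!bF => /(canRL (addrK _)) E'; rewrite [LHS]E'; ring.
Qed.

Lemma sum_below_h (f : 'I_n.+1 -> A) :
  \sum_(i : 'I_n.+1 | (i < psi h)%N) f i = f 0.
Proof. by rewrite psi_h; apply: big_pred1 => i; rewrite ltnS leqn0. Qed.

Lemma below_succ F x s :
  below (fun i t => F (i + psi h) t - F i t) x s = F x s - F 0 s.
Proof.
rewrite /below sumrB below_shift addrC carryC -/(below F x s).
have := below_shift F (psi h) x s; rewrite sum_below_h add0r => ->.
rewrite [X in _ - X]sum_below_h [psi h + x]addrC; ring.
Qed.

(** A cochain of H made from a function of the state by starting at the state
    that the first letter reaches from 0: it measures by how much evaluation at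
    the state 0 fails to be equivariant. *)
Definition cone F s : A := if s is g :: s' then F (psi g) s' else 0.

Lemma coboundary_cone F g s :
  coboundary (cone F) (g :: s) = cone F s - d F (psi g) s.
Proof.
case: s => [|k s]; first by rewrite coboundary_cons.
rewrite coboundary_cons inner_cons2 d_cons /= psiM; ring.
Qed.

Lemma sum_below_d F x s :
  \sum_(i : 'I_n.+1 | (i < x)%N) d F i s =
    d (below F) x s +
    (if s is k :: s' then carry x (psi k) * \sum_i F i s' else 0) - cone (below F) s.
Proof.
case: s => [|k s]; first by rewrite big1 //= subr0 addr0.
under eq_bigr do rewrite d_cons.
rewrite d_cons sumrB below_shift [inner (below F x) _]inner_sum /cone; ring.
Qed.

(** An exact identity between cochains; the last line vanishes for cocycles.
    The filler bounds z - z|_K among functions of the state. Evaluating at the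
    state 0 leaves the variation of filler z between the states 0 and psi g, for
    g the first letter. This variation is the primitive of the successive
    differences, which d_filler_jump computes as a coboundary plus the constant
    jump z. The primitive of the constant gives xcup, and commuting the primitive
    with the differential gives ecup. *)
Lemma decomposition z s :
  z s = z (map r s)
    + coboundary (fun t => filler z 0 t - cone (below (filler (jump z))) t) s
    + ecup (gysin z) s + xcup (fun t => jump z (map r t)) s
    + (filler (coboundary z) 0 s - cone (below (filler (jump (coboundary z)))) s).
Proof.
case: s => [|g s].
  rewrite /filler prism_nil coboundary_cons /= subrr; ring.
have E x t : filler z x t - filler z 0 t =
    \sum_(i : 'I_n.+1 | (i < x)%N) d (filler (jump z)) i t
    + (x : nat)%:R * jump z (map r t) - below (filler (jump (coboundary z))) x t.
  rewrite -below_succ /below; under [X in _ = X + _ - _]eq_bigr do rewrite d_filler_jump.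
  rewrite !big_split /= !sumrN.
  have -> : \sum_(i : 'I_n.+1 | (i < x)%N) jump z (map r t) = (x : nat)%:R * jump z (map r t).
    rewrite sumr_const mulr_natl; congr (_ *+ _).
    rewrite -sum1_card -(big_ord_widen _ (fun=> 1%N)) ?sum_nat_const ?card_ord ?muln1 //.
    by rewrite ltnW // ltn_ord.
  ring.
have Ew : filler z (psi g) s = filler z 0 s +
    (\sum_(i : 'I_n.+1 | (i < psi g)%N) d (filler (jump z)) i s
     + (psi g : nat)%:R * jump z (map r s)
     - below (filler (jump (coboundary z))) (psi g) s).
  by rewrite -E; ring.
have Ez : z (g :: s) = z (map r (g :: s)) + filler (coboundary z) 0 (g :: s)
    + (filler z (psi g) s - inner (filler z 0) (g :: s)).
  by have := d_filler z 0 (g :: s); rewrite d_cons add0r => ->; ring.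
have Es : \sum_(i : 'I_n.+1 | (i < psi g)%N) d (filler (jump z)) i s =
    d (below (filler (jump z))) (psi g) s + ecup (gysin z) (g :: s)
    - cone (below (filler (jump z))) s := sum_below_d (filler (jump z)) (psi g) s.
rewrite Ez Ew Es coboundaryB coboundary_cone coboundary_cons.
rewrite [xcup _ _]/= [cone _ (g :: s)]/=.
move: (ecup _ _) (inner _ _) (d _ _ _) (cone _ _) (z _) => a1 a2 a3 a4 a5.
move: (jump _ _) (below _ _ _) => a6 a7.
ring.
Qed.

Lemma filler_retract z x s : filler z x (map r s) = insert id (tau x) z (map r s).
Proof.
elim: s z x => [|g s IH] z x //.
rewrite map_cons /filler prism_cons insert_cons; congr (_ - _).
rewrite [act x _](_ : _ = x); last by rewrite /act psi_retract addr0.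
by rewrite -IH /r !iotaK.
Qed.

Lemma jump_retract z s :
  jump z (map r s) = insert id h z (map r s) - insert id 1%g z (map r s).
Proof. by rewrite /jump !filler_retract /tau psi_h. Qed.

Variables (q m : A).
Hypothesis Nq : n.+1%:R = q * m.

Lemma cocycle_mod_gysin z : cocycle_mod q z -> cocycle_mod q (gysin z).
Proof.
move=> [e Ez]; exists (fun s => gysin e s - m * jump z (map r s)) => s.
rewrite coboundary_gysin Nq (_ : coboundary z = fun t => q * e t); last exact/funext.
rewrite gysinZ; ring.
Qed.

Lemma exact_mod_gysin z : exact_mod q z -> exact_mod q (gysin z).
Proof.
move=> [c [e Ez]]; exists (gysin c), (fun s => m * jump c (map r s) + gysin e s) => s.
rewrite coboundary_gysin Nq (_ : z = fun t => coboundary c t + q * e t); last exact/funext.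
rewrite gysinD gysinZ; ring.
Qed.

Lemma exact_mod_ecup z : exact_mod q z -> exact_mod q (ecup z).
Proof.
move=> [c [e Ez]]; exists (ecup c), (ecup e) => s.
rewrite coboundary_ecup; case: s => [|g [|k s]] /=; rewrite ?mulr0 ?addr0 //.
rewrite Ez; ring.
Qed.

(** The degree 1 cochain psi is a cocycle modulo n.+1 only, whence Nq. *)
Lemma exact_mod_xcup z : exact_mod q z -> exact_mod q (xcup z).
Proof.
move=> [c [e Ez]]; exists (fun s => -1 * xcup c s), (fun s => m * ecup c s + xcup e s) => s.
rewrite -[X in coboundary X](_ : (fun t => (fun=> 0) t + -1 * xcup c t) = _); last first.
  by apply/funext => t; rewrite add0r.
rewrite coboundary_lin coboundary0 coboundary_xcup Nq.
case: s => [|g s] /=; first by ring.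
rewrite Ez; ring.
Qed.

Lemma exact_mod_insert_id z g : exact_mod q z -> exact_mod q (insert id g z).
Proof.
have idM : {morph (@id H) : x y / (x * y)%g} by [].
move=> [c [e Ez]]; exists (fun s => -1 * insert id g c s), (insert id g e) => s.
rewrite -[X in coboundary X](_ : (fun t => (fun=> 0) t + -1 * insert id g c t) = _); last first.
  by apply/funext => t; rewrite add0r.
rewrite coboundary_lin coboundary0 (coboundary_insert idM (HC g)).
by rewrite (eq_insert id g Ez) insert_lin; ring.
Qed.

Lemma exact_mod_decomposition z : cocycle_mod q z ->
  (forall g, exact_mod q (insert id g z)) ->
  exact_mod q (fun s => z s - z (map r s) - ecup (gysin z) s).
Proof.
move=> [e Ez] Dz.
have xu : exact_mod q (xcup (fun t => jump z (map r t))).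
  apply: exact_mod_xcup; have := exact_mod_lin (-1) (Dz h) (Dz 1%g).
  move=> /(exact_mod_pull retractM); apply: eq_exact_mod => s.
  rewrite jump_retract; ring.
case: xu => [c' [e' Ex]].
pose c := fun t => filler z 0 t - cone (below (filler (jump z))) t.
exists (fun t => c t + 1 * c' t).
exists (fun s => e' s + (filler e 0 s - cone (below (filler (jump e))) s)) => s.
rewrite coboundary_lin {1}(decomposition z s) Ex -/c.
rewrite (_ : coboundary z = fun t => q * e t); last exact/funext.
rewrite fillerZ [cone _ s](_ : _ = q * cone (below (filler (jump e))) s); first by ring.
case: s => [|g s] /=; first by rewrite mulr0.
by rewrite /below mulr_sumr; apply: eq_bigr => i _; rewrite filler_jumpZ.
Qed.

(** Insertion commutes with ecup, so insert g (gysin z) times the degree 2 class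
    is exact; gysin is a left inverse of this product and preserves exactness,
    which removes the class. *)
Lemma exact_mod_insert_gysin z : cocycle_mod q z ->
  (forall g, exact_mod q (insert id g z)) ->
  forall g, exact_mod q (insert id g (gysin z)).
Proof.
move=> cz Dz g.
suff : exact_mod q (ecup (insert id g (gysin z))).
  by move=> /exact_mod_gysin; apply: eq_exact_mod => s; apply: gysin_ecup.
have H1 := exact_mod_insert_id g (exact_mod_decomposition cz Dz).
have H2 := exact_mod_lin (-1) (Dz g) (exact_mod_pull retractM (Dz (r g))).
apply: eq_exact_mod (exact_mod_lin (-1) H2 H1) => s.
rewrite -insert_ecup !insertB insert_pull; ring.
Qed.

End CyclicFactor.

(** * Integral lifts on abelian p-groups *)

(** An element of maximal order in an abelian group generates a direct factor. *)
Lemma split_abelian_pgroup (p : nat) (H : finGroupType) :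
  prime p -> (p.-group [set: H])%g -> abelian [set: H] -> (1 < #|H|)%N ->
  exists (K : finGroupType) (n : nat) (h : H) (psi : H -> 'I_n.+1)
         (iota : K -> H) (pr : H -> K),
    [/\ (0 < n)%N, (p %| n.+1)%N, (#|K| < #|H|)%N, (p.-group [set: K])%g
      & abelian [set: K]] /\
    [/\ {morph psi : x y / (x * y)%g >-> x + y}, psi h = 1%N :> nat, pr h = 1%g
      & forall k, psi (iota k) = 0] /\
    [/\ {morph iota : x y / (x * y)%g}, {morph pr : x y / (x * y)%g}, cancel iota pr
      & forall g, (iota (pr g) * h ^+ psi g)%g = g].
Proof.
move=> p_pr pH cH H1.
have [h hin eh] := exponent_witness (abelian_nil cH).
have hH : exponent [set: H] = #[h]%g := eh.
have h_gt1 : (1 < #[h]%g)%N.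
  rewrite ltn_neqAle order_gt0 andbT eq_sym; apply: contraTneq H1 => h1.
  have := trivg_exponent [set: H]%G; rewrite /= hH h1 dvdnn => /eqP E.
  by rewrite -cardsT E cards1.
have /splitsP[K /complP[tiK defH]] := abelian_splits hin (esym hH) cH.
have oh : #[h]%g = #[h]%g.-1.+1 by rewrite prednK ?order_gt0.
set n := #[h]%g.-1 in oh.
have HC (x y : H) : commute x y by apply: (centsP cH); rewrite inE.
have ex_split g : exists ki : subg_of K * 'I_n.+1, (sgval ki.1 * h ^+ ki.2)%g = g.
  have : g \in (<[h]> * K)%g by rewrite defH inE.
  case/mulsgP => _ k /cycleP[i ->] kK ->.
  exists (subg K k, inord (i %% #[h]%g)) => /=.
  rewrite subgK // inordK -?oh ?ltn_pmod ?order_gt0 // expg_mod_order.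
  exact: HC.
have [split splitE] := choice ex_split.
have inj (k k' : subg_of K) (i i' : 'I_n.+1) :
    (sgval k * h ^+ i = sgval k' * h ^+ i')%g -> k = k' /\ i = i'.
  move=> E.
  have E1 : ((sgval k')^-1 * sgval k = h ^+ i' * (h ^+ i)^-1)%g.
    by apply: (mulIg (h ^+ i)%g); rewrite -!mulgA E mulVg mulg1 mulKg.
  have : ((sgval k')^-1 * sgval k)%g \in (<[h]> :&: K)%g.
    rewrite inE {1}E1 !groupM ?groupV ?mem_cycle ?subgP //.
  rewrite tiK => /set1P E2.
  have Ek : k = k' by apply/subg_inj/esym/eqP; rewrite eq_mulVg1 E2.
  split=> //; apply: val_inj => /=.
  have /eqP : (h ^+ i = h ^+ i')%g by apply: (mulgI (sgval k')); rewrite -{1}Ek E.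
  by rewrite eq_expg_mod_order oh !modn_small // => /eqP.
have hn : (h ^+ n.+1 = 1)%g by rewrite -oh expg_order.
have merge (a b c e : H) : (a * b * (c * e) = (a * c) * (b * e))%g.
  by rewrite !mulgA -(mulgA a b c) (HC b c) mulgA.
have splitP g k i : (sgval k * h ^+ nat_of_ord i)%g = g -> split g = (k, i).
  by rewrite -{1}(splitE g) => /inj[-> ->]; rewrite -surjective_pairing.
have n_gt0 : (0 < n)%N by rewrite -ltnS -oh.
have sh : split h = (1%g, inord 1) by apply: splitP; rewrite inordK // expg1 mul1g.
have cardK : #|subg_of K| = #|K|.
  by rewrite -cardsT; apply/esym/card_isog/isog_subg.
exists (subg_of K), n, h, (fun g => (split g).2), sgval, (fun g => (split g).1).
split; first split.
- exact: n_gt0.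
- have /p_natP[a ea] : p.-nat #[h]%g by apply: (mem_p_elt pH hin).
  rewrite -oh ea; case: a ea => [|a] ea; first by rewrite ea in h_gt1.
  exact: dvdn_exp.
- rewrite cardK -[X in (_ < X)%N]cardsT -defH TI_cardMg // -[X in (X < _)%N]mul1n.
  by rewrite ltn_mul2r cardG_gt0.
- rewrite /pgroup cardsT cardK; exact: (pgroupS (finset.subsetT K) pH).
- by apply/centsP => x _ y _; apply: subg_inj; apply: HC.
split; split.
- move=> x y /=.
  rewrite (splitP _ ((split x).1 * (split y).1)%g ((split x).2 + (split y).2)) //=.
  by rewrite (expg_mod _ hn) expgD [LHS]merge !splitE.
- by rewrite sh /= inordK.
- by rewrite sh.
- by move=> k; rewrite (splitP _ k 0) //= mulg1.
- by [].
- move=> x y /=.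
  rewrite (splitP _ ((split x).1 * (split y).1)%g ((split x).2 + (split y).2)) //=.
  by rewrite (expg_mod _ hn) expgD [LHS]merge !splitE.
- by move=> k; rewrite (splitP _ k 0) //= mulg1.
- exact: splitE.
Qed.

Section Lifting.
Variables (A : comNzRingType) (q : A).

Definition lifts (H : finGroupType) (z : seq H -> A) :=
  exists2 y : seq H -> A, (forall s, coboundary y s = 0)
    & exact_mod q (fun s => z s - y s).

(** A cochain on the trivial group is a function of the length, and its
    coboundary is itself, shifted, in odd degrees and zero in even degrees. So
    the even part of z is an integral cocycle and the odd part is a multiple
    of q. *)
Lemma lifts_trivial (H : finGroupType) (z : seq H -> A) :
  (#|H| <= 1)%N -> cocycle_mod q z -> lifts z.
Proof.
move=> H1 [e Ez].
have all_eq (x y : H) : x = y by apply: (fintype_le1P (T := H)).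
have dE (f : seq H -> A) x s : coboundary f (x :: s) = (odd (size s))%:R * f s.
  rewrite /coboundary.
  under eq_bigr => i _.
    have -> : bar_face i (x :: s) = s.
      apply: (@eq_from_nth _ 1%g); first by rewrite size_bar_face // -ltnS.
      by move=> l _; apply: all_eq.
    over.
  rewrite -mulr_suml; congr (_ * _) => /=.
  elim: (size s) => [|l IH]; first by rewrite big_ord_recr big_ord1 /= addrN.
  rewrite big_ord_recr /= IH -signr_odd /= negbK.
  by case: (odd l); rewrite /= ?subrr ?add0r.
exists (fun s => if odd (size s) then 0 else z s).
  by case=> // x s; rewrite dE; case: odd; rewrite ?mulr0 ?mul0r.
apply: eq_exact_mod (exact_mod_mul q (fun s => if odd (size s) then e (1%g :: s) else 0)).
move=> s /=; case: ifP => os; last by rewrite subrr mulr0.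
by rewrite -Ez dE os mul1r subr0.
Qed.

(** Classes modulo p killed by all insertions are polynomials in the degree 2
    generators of the cyclic factors, which are integral. The outer induction is
    on the order of the group, for the restriction to a complement of a cyclic
    factor; the inner one is on the degree, for the coefficient of its degree 2
    generator. *)
Lemma lifts_abelian (p : nat) (p_pr : prime p) (qp : q = p%:R) (H : finGroupType) :
  (p.-group [set: H])%g -> abelian [set: H] ->
  forall z : seq H -> A, finite_degree z -> cocycle_mod q z ->
    (forall g, exact_mod q (insert id g z)) -> lifts z.
Proof.
have [N] := ubnP #|H|; elim: N H => // N IHN H ltHN pH cH.
have [H1|H1] := leqP #|H| 1; first by move=> z _ cz _; apply: lifts_trivial.
have [K [n [h [psi [iota [pr [[n0 pn KH pK cK]
  [[psiM psih prh psi_iota] [iotaM prM iotaK splitE]]]]]]]]] :=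
  split_abelian_pgroup p_pr pH cH H1.
have HC (x y : H) : commute x y by apply: (centsP cH); rewrite inE.
have [m Nq] : exists m : A, n.+1%:R = q * m.
  by case/dvdnP: pn => m ->; exists m%:R; rewrite natrM mulrC qp.
move=> z [D /(_ _ _) zD]; have {zD} : forall s, (D.+1 <= size s)%N -> z s = 0 by [].
elim: D.+1 z => {D} [|D IHD] z zD cz Dz.
  exists (fun=> 0) => [s|]; first exact: coboundary0.
  apply: eq_exact_mod (exact_mod_mul q (fun=> 0)) => s.
  by rewrite zD // mulr0 subrr.
have [y0 cy0 ey0] : lifts (fun t => z (map iota t)).
  apply: (IHN K (leq_trans KH ltHN) pK cK).
  - by exists D => s ls; rewrite zD ?size_map.
  - exact: cocycle_mod_pull.
  - move=> k; apply: eq_exact_mod (exact_mod_pull iotaM (Dz (iota k))) => s.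
    by rewrite insert_pull.
have [y1 cy1 ey1] : lifts (gysin h psi iota pr z).
  apply: IHD.
  - exact: gysin_eq0.
  - exact: (cocycle_mod_gysin HC psiM psih iotaM prM prh psi_iota splitE Nq).
  - exact: (exact_mod_insert_gysin n0 HC psiM psih iotaM prM iotaK prh psi_iota splitE Nq).
(* The part of z on K is pulled back along the projection. *)
exists (fun s => y0 (map pr s) + 1 * ecup psi y1 s) => [s|].
  rewrite coboundary_lin (coboundary_map prM) cy0 (coboundary_ecup psiM).
  by case: s => [|a [|b s]] /=; rewrite ?cy1 ?mulr0 addr0.
have H0 := exact_mod_pull prM ey0.
have H1' := exact_mod_ecup psiM ey1.
have H2 := exact_mod_decomposition HC psiM psih iotaM prM iotaK prh psi_iota splitE Nq cz Dz.
apply: eq_exact_mod (exact_mod_lin 1 (exact_mod_lin 1 H2 H0) H1') => s.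
rewrite -map_comp.
have -> : ecup psi (fun s => gysin h psi iota pr z s - y1 s) s =
  ecup psi (gysin h psi iota pr z) s - ecup psi y1 s.
  by case: s => [|a [|b s]] /=; rewrite ?subrr // mulrBr.
rewrite /comp; ring.
Qed.
End Lifting.

(** * Restriction of p-torsion classes *)

(** The restriction itself vanishes, which is stronger than vanishing at all
    points of the variety: the lift provided by lifts_abelian makes p times the
    restricted cocycle equal to p times a coboundary. *)
Lemma res_torsion (A : comNzRingType) (p : nat) (p_pr : prime p)
    (pA : forall a : A, a *+ p = 0 -> a = 0)
    (G : finGroupType) (pG : (p.-group [set: G])%g) (x : even_cohomology A G) :
  x *+ p = 0 -> res A ('Z([set: G]) :&: 'Phi([set: G]))%G x = 0.
Proof.
set H := (_ :&: _)%G => px.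
apply: val_inj; case: x px => x xe /= /(congr1 val); rewrite raddfMn /= => {xe}.
have [c ->] : exists c, x = cclass c.
  by exists (generic_quotient.repr x); rewrite cclass_repr.
rewrite cohomology_pull_class -raddfMn -[RHS](raddf0 (@cclass A G)).
move=> /cclass_eq; rewrite subr0 => /asboolP[b Eb].
have {}Eb s : coboundary b s = p%:R * c s.
  have cX n : cocycle_val (c *+ n) s = n%:R * c s.
    elim: n => [|n IH]; first by rewrite mul0r.
    by rewrite mulrS cochainD IH mulrS mulrDl mul1r.
  by rewrite -cX Eb.
have HC (g : G) (k : subg_of H) : commute g (sgval k).
  have /setIP[/centerP[_ kC] _] := subgP k.
  by apply/commute_sym/kC; rewrite inE.
have [y cy [c' [e Ee]]] : lifts p%:R (fun s => b (map (@sgval G H) s)).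
  apply: (lifts_abelian p_pr erefl).
  - have /pgroupS/(_ pG) := finset.subsetT H; rewrite /pgroup cardsT.
    by rewrite -[#|subg_of H|]cardsT -(card_isog (isog_subg H)).
  - by apply/centsP => k _ l _; apply: subg_inj; apply: HC.
  - case: (b) => f /= /asboolP[n fn]; exists n => s ls.
    by rewrite fn ?size_map.
  - by exists (fun s => c (map sgval s)) => s; rewrite (coboundary_map (@sgval_morph G H)) Eb.
  move=> k; have /setIP[_ kPhi] := subgP k.
  have bc : cocycle_mod p%:R b by exists c.
  apply: eq_exact_mod (exact_insert_Phi (@sgval_morph G H) HC bc pG kPhi) => s.
  by rewrite insert_pull insert_map.
have {y cy c' Ee} ce s : c (map sgval s) = coboundary e s.
  apply/eqP; rewrite -subr_eq0; apply/eqP/pA; rewrite -mulr_natl mulrBr -Eb.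
  rewrite -(coboundary_map (@sgval_morph G H)).
  have -> : (fun s => b (map (@sgval G H) s)) =
      (fun s => (coboundary c' s + p%:R * e s) + 1 * y s).
    by apply/funext => t; rewrite -Ee mul1r subrK.
  by rewrite !coboundary_lin coboundary_coboundary cy mulr0 addr0 add0r subrr.
have [n cn] : finite_degree c by case: (cocycle_val c) => f /= /asboolP.
(* The cochain e may have infinite degree; it is cut off above the degree of c. *)
have e_fin : (fun s => if (size s <= n)%N then e s else 0) \in @cochain_pred A (subg_of H).
  by apply/asboolP; exists n => s; rewrite ltnNge => /negbTE ->.
rewrite -[RHS](raddf0 (@cclass A (subg_of H))).
apply/cclass_eq; rewrite subr0; apply/asboolP; exists (MkCochain e_fin).
apply: cochainP => s /=; rewrite [LHS]ce.
have [le_sn|lt_ns] := leqP (size s).-1 n.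
  by apply: eq_coboundary_size => t ->; rewrite le_sn.
rewrite -ce cn ?size_map; last by apply: leq_trans lt_ns (leq_pred _).
rewrite -[LHS](coboundary0 A s); apply: eq_coboundary_size => t ->.
by rewrite leqNgt lt_ns.
Qed.

Lemma Zloc_torsion_free (p : nat) (p_gt0 : (0 < p)%N) (a : Zloc p) :
  a *+ p = 0 -> a = 0.
Proof.
move=> /(congr1 val); rewrite raddfMn /= => /eqP.
by rewrite Num.Theory.mulrn_eq0 gtn_eqF //= => /eqP a0; apply: val_inj.
Qed.

Theorem theorem11p9 (p : nat) (p_prime : prime p)
    (k : closedFieldType) (char_k : p \in [pchar k]%R)
    (G : finGroupType) (pG : (p.-group [set: G])%g) :
  (range (W_res p k ('Z([set: G]) :&: 'Phi([set: G]))%G) `<=` W1 p k G)%classic.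
Proof.
move=> _ [phi _ <-] x /= px.
rewrite /W_res /= (res_torsion p_prime _ pG px) ?rmorph0 //.
by move=> a; apply: Zloc_torsion_free; apply: prime_gt0.
Qed.
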